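(* For all $n\ge0$ the first associated functions of the deformed Cauchy-Laguerre system satisfy, for $x,y\in\mathbb C\setminus[0,\infty)$ (away from poles), $$x\partial_{x} P^{(1)}_{n}(x) = -(n+b+1+x)P^{(1)}_{n}(x) + \pi_{n}\big( 1-\hat{P}^{(1)}_{n}(x) \big) - \xi s^{a+1}e^{-s}P_{n}(s) K^{1,1}_{n}(x,-s) - \psi t^{b+1}e^{-t}P^{(1)}_{n}(-t) K^{1,0}_{n}(x,t),$$ $$y\partial_{y} Q^{(1)}_{n}(y) = -(n+a+1+y)Q^{(1)}_{n}(y) + \eta_{n}\big( 1-\check{Q}^{(1)}_{n}(y) \big) - \xi s^{a+1}e^{-s}Q^{(1)}_{n}(-s) K^{0,1}_{n}(s,y) - \psi t^{b+1}e^{-t}Q_{n}(t) K^{1,1}_{n}(-t,y),$$ or equivalently \begin{multline*} x\partial_{x} P^{(1)}_{n}(x) = -(n+b+1+x)P^{(1)}_{n}(x) + \pi_{n}\big( 1-\hat{P}^{(1)}_{n}(x) \big)\\ - \xi s^{a+1}e^{-s}\tfrac{P_{n}(s)}{x-s}\Big\{ \big[ \check{Q}^{(1)}_{n}(-s)-1 \big]\big[ \hat{P}^{(1)}_{n}(x)-1 \big] + \tfrac{S_{n}}{S_{n+1}} Q^{(1)}_{n+1}(-s)P^{(1)}_{n}(x) + \tfrac{S_{n}}{S_{n+1}} Q^{(1)}_{n}(-s)P^{(1)}_{n+1}(x) \Big\}\\ - \psi t^{b+1}e^{-t}\tfrac{P^{(1)}_{n}(-t)}{x+t}\Big\{ \check{Q}_{n}(t)\big[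 \hat{P}^{(1)}_{n}(x)-1 \big] + \tfrac{S_{n}}{S_{n+1}} Q_{n+1}(t)P^{(1)}_{n}(x) + \tfrac{S_{n}}{S_{n+1}} Q_{n}(t)P^{(1)}_{n+1}(x) \Big\}, \end{multline*} \begin{multline*} y\partial_{y} Q^{(1)}_{n}(y) = -(n+a+1+y)Q^{(1)}_{n}(y) + \eta_{n}\big( 1-\check{Q}^{(1)}_{n}(y) \big)\\ - \xi s^{a+1}e^{-s}\tfrac{Q^{(1)}_{n}(-s)}{s+y}\Big\{ \hat{P}_{n}(s)\big[ \check{Q}^{(1)}_{n}(y)-1 \big] + \tfrac{S_{n}}{S_{n+1}}P_{n+1}(s)Q^{(1)}_{n}(y) + \tfrac{S_{n}}{S_{n+1}}P_{n}(s)Q^{(1)}_{n+1}(y) \Big\}\\ - \psi t^{b+1}e^{-t}\tfrac{Q_{n}(t)}{y-t}\Big\{ \big[ \hat{P}^{(1)}_{n}(-t)-1 \big]\big[ \check{Q}^{(1)}_{n}(y)-1 \big] + \tfrac{S_{n}}{S_{n+1}} P^{(1)}_{n+1}(-t)Q^{(1)}_{n}(y) + \tfrac{S_{n}}{S_{n+1}} P^{(1)}_{n}(-t)Q^{(1)}_{n+1}(y) \Big\}. \end{multline*}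
   Context: Fix $a,b,\xi,\psi\in\mathbb C$ with $\Re a,\Re b>-1$. For $s,t>0$ put $w_1(x)=(1-\xi\chi_{x>s})x^ae^{-x}$, $w_2(y)=(1-\psi\chi_{y>t})y^be^{-y}$ on $(0,\infty)$, $\langle f,g\rangle=\int_0^\infty\int_0^\infty\frac{w_1(x)w_2(y)}{x+y}f(x)g(y)\,dx\,dy$, $M_{j,k}=\langle x^j,y^k\rangle$, $Z_0=1$, $Z_n=\det(M_{j,k})_{0\le j,k\le n-1}$. $P_n,Q_n$ are polynomials of degree $n$ with the same leading coefficient $S_n$ ($S_n^2=Z_n/Z_{n+1}$) and $\langle P_m,Q_n\rangle=\delta_{m,n}$. $\pi_n=\int_0^\infty w_1P_n\,dx$, $\eta_n=\int_0^\infty w_2Q_n\,dy$. Standing generic conditions: all $M_{j,k}$ finite (absolutely convergent), $Z_n\ne0$, $\pi_n,\eta_n\ne0$ for all $n\ge0$. For polynomials $P$ in $x$ (including $P_n,\hat P_n$) $P^{(1)}(z)=\int_0^\infty\frac{w_1(x)}{z-x}P(x)\,dx$; for polynomials $Q$ in $y$ (including $Q_n,\check Q_n$) $Q^{(1)}(z)=\int_0^\infty\frac{w_2(y)}{z-y}Q(y)\,dy$. $\hat P_n=-\sum_{k=0}^n\eta_kP_k$, $\check Q_n=-\sum_{j=0}^n\pi_jQ_j$. $K^{0,1}_n(x,y)=\sum_{l=0}^nP_l(x)Q^{(1)}_l(y)$, $K^{1,0}_n(x,y)=\sum_{l=0}^nP^{(1)}_l(x)Q_l(y)$, $K^{1,1}_n(x,y)=\sum_{l=0}^nP^{(1)}_l(x)Q^{(1)}_l(y)+\frac1{x+y}$.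 *)

(* Defs.v *)
From HB Require Import structures.
From mathcomp Require Import all_boot all_order all_algebra.
From mathcomp Require Import complex.
From mathcomp Require Import all_classical all_reals all_analysis.

Set Implicit Arguments.
Unset Strict Implicit.
Unset Printing Implicit Defensive.

Import Order.TTheory GRing.Theory Num.Theory.
Import numFieldTopology.Exports numFieldNormedType.Exports.

Local Open Scope classical_set_scope.
Local Open Scope ring_scope.
Local Open Scope complex_scope.

(* MathComp-Analysis integrates real-valued functions; a complex-valued
   function is integrated through its real and imaginary parts.  It is
   absolutely integrable iff both parts are. *)
Section complex_integral.
Context d (T : measurableType d) (R : realType).
Implicit Types (mu : {measure set T -> \bar R}) (D : set T) (f : T -> R[i]).

Definition cintegrable mu D f :=
  mu.-integrable D (EFin \o (fun u => complex.Re (f u))) /\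
  mu.-integrable D (EFin \o (fun u => complex.Im (f u))).

Definition cintegral mu D f : R[i] :=
  (\int[mu]_(u in D) complex.Re (f u)) +i* (\int[mu]_(u in D) complex.Im (f u)).

End complex_integral.

Section deformed_cauchy_laguerre.
Context (R : realType).
Implicit Types (w : R -> R[i]) (f g : {poly R[i]}) (P Q : nat -> {poly R[i]}).
Implicit Types (a xi z : R[i]) (s u : R) (n j k : nat).

Local Notation mu := (@lebesgue_measure R).

(* [u ^ a = exp (a * ln u)] for [0 < u]; its values at [u <= 0] are junk and
   never matter, all integrals below being over the open half-line. *)
Definition cpow u a : R[i] :=
  (u `^ complex.Re a)%:C *
  (cos (complex.Im a * ln u) +i* sin (complex.Im a * ln u)).

Definition weight a xi s u : R[i] :=
  (1 - (if s < u then xi else 0)) * cpow u a * (expR (- u))%:C.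

Definition halfline : set R := `]0, +oo[.
Definition quadrant : set (R * R) := halfline `*` halfline.

Definition pairing_integrand w1 w2 f g (p : R * R) : R[i] :=
  w1 p.1 * w2 p.2 / (p.1 + p.2)%:C * f.[p.1%:C] * g.[p.2%:C].

Definition pairing w1 w2 f g : R[i] :=
  cintegral (mu \x mu)%E quadrant (pairing_integrand w1 w2 f g).

Definition moment_finite w1 w2 j k :=
  cintegrable (mu \x mu)%E quadrant (pairing_integrand w1 w2 'X^j 'X^k).

Definition moment w1 w2 j k : R[i] := pairing w1 w2 'X^j 'X^k.

(* [n = 0] gives the empty determinant, i.e. 1. *)
Definition Zdet w1 w2 n : R[i] :=
  \det (\matrix_(j < n, k < n) moment w1 w2 j k).

Definition wint w f : R[i] := cintegral mu halfline (fun u => w u * f.[u%:C]).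

(* The first associated function (weighted Cauchy transform) of [f]. *)
Definition assoc w f z : R[i] :=
  cintegral mu halfline (fun u => w u / (z - u%:C) * f.[u%:C]).

Definition Phat w2 P Q n : {poly R[i]} :=
  - \sum_(k < n.+1) wint w2 (Q k) *: P k.

Definition Qcheck w1 P Q n : {poly R[i]} :=
  - \sum_(j < n.+1) wint w1 (P j) *: Q j.

Definition K01 w2 P Q n (x y : R[i]) : R[i] :=
  \sum_(l < n.+1) (P l).[x] * assoc w2 (Q l) y.

Definition K10 w1 P Q n (x y : R[i]) : R[i] :=
  \sum_(l < n.+1) assoc w1 (P l) x * (Q l).[y].

Definition K11 w1 w2 P Q n (x y : R[i]) : R[i] :=
  (\sum_(l < n.+1) assoc w1 (P l) x * assoc w2 (Q l) y) + (x + y)^-1.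

(* The complex plane minus the closed half-line [0, +oo). *)
Definition cut_plane : set R[i] := ~` [set r%:C | r in `[0, +oo[%classic].

End deformed_cauchy_laguerre.

(* Main.v *)
(* Integrating by parts against [u w'(u) = (a - u) w(u)] on the two sides of the
   jump at [s] turns [x d/dx] of the Cauchy transform of [w1 P] into the Cauchy
   transform of [a P - u P + u P'], plus a boundary term at [s].  The same
   integration by parts in both variables of the pairing, whose kernel
   [1 / (x + y)] is homogeneous of degree [-1], gives
     <x P', Q> + <P, y Q'> = - (a + b + 1) <P, Q> + (int w1 P) (int w2 Q)
                             + boundary terms at s and t.
   Taking [P = P_n] and [Q = Q_l] for [l <= n] yields the coefficients of [x P_n']
   in the basis [P_0, ..., P_n], hence the first form of the equation.  The second
   form follows from the Christoffel-Darboux formula, a consequence of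
   <x P, Q> + <P, y Q> = (int w1 P) (int w2 Q).  The equation for [Q_n] is the
   equation for [P_n] with the roles of the two variables exchanged. *)
Require Import Defs.
From HB Require Import structures.
From mathcomp Require Import all_boot all_order all_algebra.
From mathcomp Require Import complex ring lra.
From mathcomp Require Import all_classical all_reals all_analysis.
From mathcomp Require Import measurable_realfun.

Set Implicit Arguments.
Unset Strict Implicit.
Unset Printing Implicit Defensive.

Import Order.TTheory GRing.Theory Num.Theory.
Import numFieldTopology.Exports numFieldNormedType.Exports.

Local Open Scope classical_set_scope.
Local Open Scope ring_scope.
Local Open Scope complex_scope.

(** A single integration by parts, [cintegral_by_parts], is used twice. Its parameter [x] is first
    the argument of a Cauchy transform. For the pairing one variable is frozen: since 1/(x+y) =
    -1/((-x)-y), the inner integral is, up to sign, a Cauchy transform at -x, so no boundary of a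
    planar domain ever appears. What remains are double integrals with kernel 1/(x+y)^2, one from
    each variable, and x/(x+y)^2 + y/(x+y)^2 = 1/(x+y) turns their sum back into the pairing. This
    extra 1 changes -(1+a)-(1+b) into -(a+b+1).

    The obstacle is integrability: the hypotheses control only double integrals that contain the
    kernel, whereas Cauchy transforms need the moments of each weight alone. Fubini recovers them
    from a slice below the jump of the other weight, where that weight is nonzero whatever [xi] is.

    A weight may be singular at 0 and breaks at [s], so integrals are computed on [1/(k+1), k+1] cut
    at [s]. The condition Re a > -1 removes the boundary term at 0, the exponential the one at
    infinity, and the jump leaves F(s) - (1 - xi) F(s) = xi F(s). *)

(** * Real and imaginary parts, and the norm |Re z| + |Im z| *)

Section norm1.
Context {R : realType}.
Implicit Types z w : R[i].

Lemma cReM z w : complex.Re (z * w) =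
  complex.Re z * complex.Re w - complex.Im z * complex.Im w.
Proof. by case: z w => [? ?] [? ?]. Qed.

Lemma cImM z w : complex.Im (z * w) =
  complex.Re z * complex.Im w + complex.Im z * complex.Re w.
Proof. by case: z w => [? ?] [? ?]. Qed.

Lemma cReD z w : complex.Re (z + w) = complex.Re z + complex.Re w.
Proof. by case: z w => [? ?] [? ?]. Qed.

Lemma cImD z w : complex.Im (z + w) = complex.Im z + complex.Im w.
Proof. by case: z w => [? ?] [? ?]. Qed.

Lemma cReV z : complex.Re z^-1 =
  complex.Re z * (complex.Re z ^+ 2 + complex.Im z ^+ 2)^-1.
Proof. by case: z. Qed.

Lemma cImV z : complex.Im z^-1 =
  - complex.Im z * (complex.Re z ^+ 2 + complex.Im z ^+ 2)^-1.
Proof. by case: z => x y; rewrite mulNr. Qed.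

(* Submultiplicative like the modulus, but manifestly measurable and free of
   square roots. *)
Definition norm1 z : R := `|complex.Re z| + `|complex.Im z|.

Lemma norm1_ge0 z : 0 <= norm1 z.
Proof. by rewrite addr_ge0. Qed.

Lemma norm1D z w : norm1 (z + w) <= norm1 z + norm1 w.
Proof.
rewrite /norm1 cReD cImD addrACA; apply: lerD; exact: ler_normD.
Qed.

Lemma norm1M z w : norm1 (z * w) <= norm1 z * norm1 w.
Proof.
rewrite /norm1 cReM cImM.
apply: (le_trans (lerD (ler_normB _ _) (ler_normD _ _))).
rewrite !normrM le_eqVlt; apply/orP; left; apply/eqP; ring.
Qed.

Lemma norm1_real (r : R) : norm1 r%:C = `|r|.
Proof. by rewrite /norm1 /= normr0 addr0. Qed.

Lemma norm1N z : norm1 (- z) = norm1 z.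
Proof. by case: z => x y; rewrite /norm1 /= !normrN. Qed.

(** Here [norm1 z^-1] is (X + Y)/(X^2 + Y^2) with X, Y the absolute values of the two parts; the
    constant 2 comes from (X + Y)^2 <= 2 (X^2 + Y^2). *)
Lemma norm1V_le z (e : R) : 0 < e -> e <= norm1 z -> norm1 z^-1 <= 2 / e.
Proof.
case: z => x y; rewrite /norm1 => e0 /=.
set X := `|x|; set Y := `|y| => eXY.
have X0 : 0 <= X := normr_ge0 _.
have Y0 : 0 <= Y := normr_ge0 _.
have XY0 : 0 < X + Y := lt_le_trans e0 eXY.
have N : x ^+ 2 + y ^+ 2 = X ^+ 2 + Y ^+ 2 by rewrite /X /Y !real_normK ?num_real.
have D0 : 0 < X ^+ 2 + Y ^+ 2.
  by have := exprn_gt0 2 XY0; have := sqr_ge0 (X - Y); nra.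
rewrite normrN !normrM N normfV (ger0_norm (ltW D0)) -mulrDl.
rewrite ler_pdivrMr// mulrAC ler_pdivlMr//.
rewrite -/X -/Y.
have : e * (X + Y) <= (X + Y) ^+ 2 by rewrite expr2 ler_wpM2r// ltW.
by have := sqr_ge0 (X - Y); nra.
Qed.

Lemma norm_le_norm1 z : `|z| <= (norm1 z)%:C.
Proof.
rewrite normc_def lecR -(ler_pXn2r (n := 2))// ?nnegrE ?sqrtr_ge0 ?norm1_ge0//.
rewrite sqr_sqrtr ?addr_ge0 ?sqr_ge0// /norm1.
have E (r : R) : r ^+ 2 = `|r| ^+ 2 by rewrite real_normK ?num_real.
rewrite [complex.Re z ^+ 2]E [complex.Im z ^+ 2]E.
have := normr_ge0 (complex.Re z); have := normr_ge0 (complex.Im z).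
set X := `|_|; set Y := `|_|; nra.
Qed.

Lemma realC_neq0 (r : R) : 0 < r -> r%:C != 0 :> R[i].
Proof. by move=> r0; rewrite eq_complex /= eqxx andbT gt_eqF. Qed.

Lemma Re_le_norm1 z : `|complex.Re z| <= norm1 z.
Proof. by rewrite lerDl. Qed.

Lemma Im_le_norm1 z : `|complex.Im z| <= norm1 z.
Proof. by rewrite lerDr. Qed.

End norm1.

(** * Measurability of complex-valued functions *)

Section complex_measurable.
Context d (T : measurableType d) (R : realType).
Implicit Types (D : set T) (f g : T -> R[i]).

Definition cmeasurable D f :=
  measurable_fun D (fun u => complex.Re (f u)) /\
  measurable_fun D (fun u => complex.Im (f u)).

Lemma cmeasurable_cst D (c : R[i]) : cmeasurable D (fun=> c).
Proof. by split; exact: measurable_cst. Qed.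

Lemma cmeasurable_real D (h : T -> R) :
  measurable_fun D h -> cmeasurable D (fun u => (h u)%:C).
Proof. by split => //=; exact: measurable_cst. Qed.

Lemma cmeasurableD D f g : cmeasurable D f -> cmeasurable D g ->
  cmeasurable D (fun u => f u + g u).
Proof.
move=> [f1 f2] [g1 g2]; split.
  by under eq_fun do rewrite cReD; exact: measurable_funD.
by under eq_fun do rewrite cImD; exact: measurable_funD.
Qed.

Lemma cmeasurableM D f g : cmeasurable D f -> cmeasurable D g ->
  cmeasurable D (fun u => f u * g u).
Proof.
move=> [f1 f2] [g1 g2]; split.
  by under eq_fun do rewrite cReM; apply: measurable_funB; exact: measurable_funM.
by under eq_fun do rewrite cImM; apply: measurable_funD; exact: measurable_funM.
Qed.

Lemma cmeasurableB D f g : cmeasurable D f -> cmeasurable D g ->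
  cmeasurable D (fun u => f u - g u).
Proof.
move=> mf mg; have := cmeasurableD mf (cmeasurableM (cmeasurable_cst D (-1)) mg).
by under eq_fun do rewrite mulN1r.
Qed.

Lemma cmeasurableV D f : cmeasurable D f -> cmeasurable D (fun u => (f u)^-1).
Proof.
move=> [f1 f2].
have m : measurable_fun D (fun u =>
    (complex.Re (f u) ^+ 2 + complex.Im (f u) ^+ 2)^-1).
  (* For a nonnegative real the inverse is the power of exponent -1, at 0 too, so zeros of [f] need
     no separate treatment. *)
  under eq_fun do rewrite -powR_inv1 ?addr_ge0 ?sqr_ge0//.
  apply: (measurableT_comp (measurable_powR _)).
  by apply: measurable_funD; exact: measurable_funX.
split.
  by under eq_fun do rewrite cReV; exact: measurable_funM.
under eq_fun do rewrite cImV.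
by apply: measurable_funM => //; exact: measurable_funN.
Qed.

Lemma cmeasurable_horner D (p : {poly R[i]}) f : cmeasurable D f ->
  cmeasurable D (fun u => p.[f u]).
Proof.
move=> mf; elim/poly_ind: p => [|p c IH].
  by under eq_fun do rewrite horner0; exact: cmeasurable_cst.
under eq_fun do rewrite hornerMXaddC.
apply: cmeasurableD; last exact: cmeasurable_cst.
exact: cmeasurableM.
Qed.

End complex_measurable.

(** * Integrability and linearity of the complex integral *)

Section complex_integrable.
Context d (T : measurableType d) (R : realType) (mu : {measure set T -> \bar R}).
Implicit Types (D : set T) (f g : T -> R[i]).

Lemma cintegrable_cmeasurable D f : cintegrable mu D f -> cmeasurable D f.
Proof.
by move=> [/measurable_int/measurable_EFinP ? /measurable_int/measurable_EFinP].
Qed.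

Lemma cintegrable_le D f (h : T -> R) : measurable D -> cmeasurable D f ->
  mu.-integrable D (EFin \o h) -> (forall u, D u -> norm1 (f u) <= h u) ->
  cintegrable mu D f.
Proof.
move=> mD [f1 f2] ih fh; split; apply: le_integrable ih => //.
- exact/measurable_EFinP.
- move=> u Du /=; rewrite lee_fin (le_trans (Re_le_norm1 _))//.
  by rewrite (le_trans (fh _ Du))// ler_norm.
- exact/measurable_EFinP.
- move=> u Du /=; rewrite lee_fin (le_trans (Im_le_norm1 _))//.
  by rewrite (le_trans (fh _ Du))// ler_norm.
Qed.

Lemma integrable_norm1 D f : measurable D -> cintegrable mu D f ->
  mu.-integrable D (EFin \o (fun u => norm1 (f u))).
Proof.
move=> mD [f1 f2].
rewrite (_ : _ \o _ = (EFin \o (Num.norm \o (fun u => complex.Re (f u)))) \+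
                      (EFin \o (Num.norm \o (fun u => complex.Im (f u)))))%E //.
by apply: integrableD => //; exact: integrable_norm.
Qed.

(** Source of most integrability facts below: the bounded factor is a power of 1/(x-u) away from the
    half-line, or y/(x+y) on the quadrant. *)
Lemma cintegrable_mulbnd D f g (M : R) : measurable D -> cintegrable mu D f ->
  cmeasurable D g -> (forall u, D u -> norm1 (g u) <= M) ->
  cintegrable mu D (fun u => f u * g u).
Proof.
move=> mD If mg gM.
apply: (@cintegrable_le _ _ (fun u => M * norm1 (f u))) => //.
- by apply: cmeasurableM => //; exact: cintegrable_cmeasurable.
- exact: (integrableZl mD M (integrable_norm1 mD If)).
- move=> u Du; rewrite mulrC (le_trans (norm1M _ _))//.
  by rewrite ler_wpM2r ?norm1_ge0 ?gM.
Qed.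

Lemma cintegrable0 D : cintegrable mu D (fun=> 0).
Proof. by split; exact: integrable0. Qed.

Lemma cintegrableD D f g : measurable D -> cintegrable mu D f ->
  cintegrable mu D g -> cintegrable mu D (fun u => f u + g u).
Proof.
move=> mD [f1 f2] [g1 g2]; split.
  rewrite (_ : _ \o _ = (EFin \o (fun u => complex.Re (f u))) \+
    (EFin \o (fun u => complex.Re (g u))))%E ?integrableD//.
  by apply/funext => u /=; rewrite cReD.
rewrite (_ : _ \o _ = (EFin \o (fun u => complex.Im (f u))) \+
  (EFin \o (fun u => complex.Im (g u))))%E ?integrableD//.
by apply/funext => u /=; rewrite cImD.
Qed.

Lemma cintegrableZ D (c : R[i]) f : measurable D -> cintegrable mu D f ->
  cintegrable mu D (fun u => c * f u).
Proof.
move=> mD If; rewrite (_ : (fun u => _) = (fun u => f u * c)); last first.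
  by apply/funext => u; rewrite mulrC.
exact: (@cintegrable_mulbnd D f (fun=> c) (norm1 c) mD If).
Qed.

Lemma cintegrable_sum I (r : seq I) D (f : I -> T -> R[i]) : measurable D ->
  (forall i, cintegrable mu D (f i)) ->
  cintegrable mu D (fun u => \sum_(i <- r) f i u).
Proof.
move=> mD mf; elim: r => [|i r IH].
  by under eq_fun do rewrite big_nil; exact: cintegrable0.
by under eq_fun do rewrite big_cons; exact: cintegrableD.
Qed.

Lemma eq_cintegrable D f g : measurable D -> {in D, f =1 g} ->
  cintegrable mu D f -> cintegrable mu D g.
Proof.
by move=> mD fg [f1 f2]; split; [move: f1|move: f2];
  apply: eq_integrable => // u uD /=; rewrite fg.
Qed.

Lemma cintegrableS (E D : set T) f : measurable E -> measurable D -> D `<=` E ->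
  cintegrable mu E f -> cintegrable mu D f.
Proof. by move=> mE mD DE [f1 f2]; split; exact: (integrableS mE). Qed.

Lemma eq_cintegral D f g : {in D, f =1 g} ->
  cintegral mu D f = cintegral mu D g.
Proof.
move=> fg; rewrite /cintegral; congr (_ +i* _); apply: eq_Rintegral => u uD;
  by rewrite fg.
Qed.

Lemma cintegralD D f g : measurable D -> cintegrable mu D f ->
  cintegrable mu D g -> cintegral mu D (fun u => f u + g u) =
  cintegral mu D f + cintegral mu D g.
Proof.
move=> mD [f1 f2] [g1 g2]; rewrite /cintegral.
under eq_Rintegral do rewrite cReD.
under [X in _ +i* X]eq_Rintegral do rewrite cImD.
by rewrite !RintegralD.
Qed.

Lemma cintegralZ D (c : R[i]) f : measurable D -> cintegrable mu D f ->
  cintegral mu D (fun u => c * f u) = c * cintegral mu D f.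
Proof.
move=> mD [f1 f2]; rewrite /cintegral; case: c => cr ci.
under eq_Rintegral do rewrite cReM.
under [X in _ +i* X]eq_Rintegral do rewrite cImM.
rewrite RintegralB//; last 2 first.
- exact: (integrableZl mD cr f1).
- exact: (integrableZl mD ci f2).
rewrite RintegralD//; last 2 first.
- exact: (integrableZl mD cr f2).
- exact: (integrableZl mD ci f1).
by rewrite !RintegralZl.
Qed.

Lemma cintegral_setU (A B : set T) f : measurable A -> measurable B ->
  cintegrable mu (A `|` B) f -> [disjoint A & B] ->
  cintegral mu (A `|` B) f = cintegral mu A f + cintegral mu B f.
Proof.
by move=> mA mB [f1 f2] AB; rewrite /cintegral !Rintegral_setU.
Qed.

Lemma norm1_cintegral_le D f (h : T -> R) : measurable D -> cintegrable mu D f ->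
  mu.-integrable D (EFin \o h) -> (forall u, D u -> norm1 (f u) <= h u) ->
  norm1 (cintegral mu D f) <= \int[mu]_(u in D) h u.
Proof.
move=> mD [f1 f2] ih fh; rewrite /norm1 /cintegral /=.
apply: (le_trans (lerD (le_normr_Rintegral mD f1) (le_normr_Rintegral mD f2))).
rewrite -RintegralD//; last 2 first.
- exact: integrable_norm.
- exact: integrable_norm.
apply: le_Rintegral => //.
exact: (@integrable_norm1 D f).
Qed.

End complex_integrable.

(** * Fubini's theorem on rectangles *)

Section product_integrals.
Context d1 d2 (T1 : measurableType d1) (T2 : measurableType d2) (R : realType).
Variables (m1 : {sigma_finite_measure set T1 -> \bar R}).
Variables (m2 : {sigma_finite_measure set T2 -> \bar R}).
Variables (D1 : set T1) (D2 : set T2).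
Hypotheses (mD1 : measurable D1) (mD2 : measurable D2).
Implicit Types (f : T1 * T2 -> R) (F : T1 * T2 -> R[i]).

Let mD12 : measurable (D1 `*` D2). Proof. exact: measurableX. Qed.
Let mD21 : measurable (D2 `*` D1). Proof. exact: measurableX. Qed.

(** Integrals over a rectangle are handled as integrals of the extension by zero, to which Fubini on
    the whole product applies; this identity makes the extension commute with the exchange of
    variables. *)
Let swap_patch f :
  ((EFin \o (fun p => f (p.2, p.1))) \_ (D2 `*` D1)) =
  ((EFin \o f) \_ (D1 `*` D2)) \o (@unstable.swap T2 T1).
Proof.
apply/funext => -[x y] /=; rewrite /patch /=.
have -> // : ((x, y) \in D2 `*` D1) = ((y, x) \in D1 `*` D2).
by apply/idP/idP => /set_mem [? ?]; apply/mem_set.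
Qed.

Lemma integrable_swap f : (m1 \x m2)%E.-integrable (D1 `*` D2) (EFin \o f) ->
  (m2 \x m1)%E.-integrable (D2 `*` D1) (EFin \o (fun p => f (p.2, p.1))).
Proof.
move/(integrable_mkcond _ mD12) => if_.
apply/(integrable_mkcond _ mD21); rewrite swap_patch.
set g := _ \_ _ in if_ *.
have mg := measurable_int _ if_.
apply/integrable12ltyP.
  exact: (measurableT_comp mg (@measurable_swap _ _ T2 T1)).
by move/(integrable21ltyP _ _ mg) : if_.
Qed.

Lemma Rintegral_swap f : (m1 \x m2)%E.-integrable (D1 `*` D2) (EFin \o f) ->
  \int[(m2 \x m1)%E]_(p in D2 `*` D1) f (p.2, p.1) =
  \int[(m1 \x m2)%E]_(p in D1 `*` D2) f p.
Proof.
move=> if_; have ig := integrable_swap if_; rewrite /Rintegral; congr fine.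
rewrite integral_mkcond [RHS]integral_mkcond.
move/(integrable_mkcond _ mD12) : if_ => if_.
move/(integrable_mkcond _ mD21) : ig => ig.
rewrite -(integral21_prod_meas1 if_) -(integral12_prod_meas1 ig).
apply: eq_integral => y _; apply: eq_integral => x _.
by rewrite swap_patch.
Qed.

Lemma cintegrable_swap F : cintegrable (m1 \x m2)%E (D1 `*` D2) F ->
  cintegrable (m2 \x m1)%E (D2 `*` D1) (fun p => F (p.2, p.1)).
Proof.
by move=> [f1 f2]; split; [exact: (integrable_swap f1)|exact: (integrable_swap f2)].
Qed.

Lemma cintegral_swap F : cintegrable (m1 \x m2)%E (D1 `*` D2) F ->
  cintegral (m2 \x m1)%E (D2 `*` D1) (fun p => F (p.2, p.1)) =
  cintegral (m1 \x m2)%E (D1 `*` D2) F.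
Proof.
move=> [f1 f2]; rewrite /cintegral; congr (_ +i* _).
  exact: (Rintegral_swap f1).
exact: (Rintegral_swap f2).
Qed.

Let patch_row f x : D1 x -> (fun y => ((EFin \o f) \_ (D1 `*` D2)) (x, y)) =
  (EFin \o (fun y => f (x, y))) \_ D2.
Proof.
move=> D1x; apply/funext => y; rewrite /patch.
have -> // : ((x, y) \in D1 `*` D2) = (y \in D2).
by apply/idP/idP => /set_mem h; apply/mem_set => //; case: h.
Qed.

(** Integrability of every row, not merely of almost every row, makes each inner integral finite, so
    that [fine] can be undone row by row. *)
Lemma Rintegral_prod f : (m1 \x m2)%E.-integrable (D1 `*` D2) (EFin \o f) ->
  (forall x, D1 x -> m2.-integrable D2 (EFin \o (fun y => f (x, y)))) ->
  \int[(m1 \x m2)%E]_(p in D1 `*` D2) f p =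
  \int[m1]_(x in D1) \int[m2]_(y in D2) f (x, y).
Proof.
move=> if_ ix; rewrite /Rintegral; congr fine.
rewrite integral_mkcond [RHS]integral_mkcond.
move/(integrable_mkcond _ mD12) : if_ => if_.
rewrite -(integral12_prod_meas1 if_).
apply: eq_integral => x _; rewrite /fubini_F [RHS]/patch.
case: ifPn => [/set_mem xD|xD].
  rewrite fineK; last by apply: (integrable_fin_num mD2); exact: ix.
  by rewrite patch_row// -integral_mkcond.
rewrite [X in integral _ _ X](_ : _ = cst 0%E); first exact: integral0.
apply/funext => y; rewrite /patch ifN//; apply: contra xD => /set_mem[? _].
exact/mem_set.
Qed.

Lemma cintegral_prod F : cintegrable (m1 \x m2)%E (D1 `*` D2) F ->
  (forall x, D1 x -> cintegrable m2 D2 (fun y => F (x, y))) ->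
  cintegral (m1 \x m2)%E (D1 `*` D2) F =
  cintegral m1 D1 (fun x => cintegral m2 D2 (fun y => F (x, y))).
Proof.
move=> [f1 f2] ix; rewrite /cintegral; congr (_ +i* _).
  by apply: (Rintegral_prod f1) => x /ix[].
by apply: (Rintegral_prod f2) => x /ix[].
Qed.

Lemma ae_cintegrable_row F : cintegrable (m1 \x m2)%E (D1 `*` D2) F ->
  {ae m1, forall x, D1 x -> cintegrable m2 D2 (fun y => F (x, y))}.
Proof.
have row f : (m1 \x m2)%E.-integrable (D1 `*` D2) (EFin \o f) ->
    {ae m1, forall x, D1 x -> m2.-integrable D2 (EFin \o (fun y => f (x, y)))}.
  move/(integrable_mkcond _ mD12)/ae_integrable1.
  apply: filterS => x ix xD; apply/(integrable_mkcond _ mD2).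
  by rewrite -patch_row.
move=> [/row f1 /row f2]; apply: filterS2 f1 f2 => x h1 h2 xD.
by split; [exact: h1|exact: h2].
Qed.

(** Both integrands are sliced at the same [x], which allows their rows to be combined
    afterwards. *)
Lemma ae_cintegrable_row2 F G : cintegrable (m1 \x m2)%E (D1 `*` D2) F ->
  cintegrable (m1 \x m2)%E (D1 `*` D2) G ->
  {ae m1, forall x, D1 x -> cintegrable m2 D2 (fun y => F (x, y)) /\
                            cintegrable m2 D2 (fun y => G (x, y))}.
Proof.
move=> /ae_cintegrable_row aeF /ae_cintegrable_row aeG.
by apply: filterS2 aeF aeG => x iF iG D1x; split; [exact: iF|exact: iG].
Qed.

End product_integrals.

(** * The open half-line and the open quadrant *)

Section halfline.
Context {R : realType}.
Local Notation mu := (@lebesgue_measure R).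
Local Notation H := (@halfline R).
Local Notation QD := (@quadrant R).
Implicit Types (F : R * R -> R[i]).

Lemma measurable_halfline : measurable (H : set (measurableTypeR R)).
Proof. exact: measurable_itv. Qed.

Lemma measurable_quadrant :
  measurable (QD : set (measurableTypeR R * measurableTypeR R)).
Proof. by apply: measurableX; exact: measurable_itv. Qed.

Lemma halflineE (u : R) : H u = (0 < u) :> Prop.
Proof. by rewrite /halfline /= in_itv /= andbT. Qed.

Lemma quadrantE (p : R * R) : QD p = (0 < p.1 /\ 0 < p.2) :> Prop.
Proof. by rewrite /quadrant /= !halflineE. Qed.

Lemma cintegrable_quadrant_swap F : cintegrable (mu \x mu)%E QD F ->
  cintegrable (mu \x mu)%E QD (fun p => F (p.2, p.1)).
Proof. exact: (cintegrable_swap measurable_halfline measurable_halfline). Qed.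

Lemma cintegral_quadrant_swap F : cintegrable (mu \x mu)%E QD F ->
  cintegral (mu \x mu)%E QD (fun p => F (p.2, p.1)) =
  cintegral (mu \x mu)%E QD F.
Proof. exact: (cintegral_swap measurable_halfline measurable_halfline). Qed.

Lemma cintegral_quadrant F : cintegrable (mu \x mu)%E QD F ->
  (forall x, 0 < x -> cintegrable mu H (fun y => F (x, y))) ->
  cintegral (mu \x mu)%E QD F =
  cintegral mu H (fun x => cintegral mu H (fun y => F (x, y))).
Proof.
move=> iF ix; apply: (cintegral_prod measurable_halfline measurable_halfline iF).
by move=> x; rewrite halflineE; exact: ix.
Qed.

Lemma eq_cintegral_quadrant F G :
  (forall u, 0 < u.1 -> 0 < u.2 -> F u = G u) ->
  cintegral (mu \x mu)%E QD F = cintegral (mu \x mu)%E QD G.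
Proof.
by move=> FG; apply: eq_cintegral => u /set_mem; rewrite quadrantE => -[]; exact: FG.
Qed.

Lemma eq_cintegrable_quadrant F G :
  (forall u, 0 < u.1 -> 0 < u.2 -> F u = G u) ->
  cintegrable (mu \x mu)%E QD F -> cintegrable (mu \x mu)%E QD G.
Proof.
move=> FG; apply: eq_cintegrable; first exact: measurable_quadrant.
by move=> u /set_mem; rewrite quadrantE => -[]; exact: FG.
Qed.

(** The interval ]0, s[ has measure s > 0, so it is not contained in a negligible set. *)
Lemma ae_pos_exists (P : R -> Prop) (s : R) : 0 < s ->
  {ae mu, forall x, P x} -> exists2 x, 0 < x < s & P x.
Proof.
move=> s0 aeP; apply: contrapT => nex.
have : mu `]0, s[%classic = 0%E.
  apply: (measure_negligible (mu := mu)); first exact: measurable_itv.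
  apply: negligibleS aeP => x /=; rewrite in_itv/= => xs Px.
  by apply: nex; exists x.
rewrite lebesgue_measure_itv /= lte_fin s0 => /eqP.
by rewrite -EFinB eqe subr0 gt_eqF.
Qed.

End halfline.

(** * Derivatives of complex-valued functions of a real variable *)

Section complex_valued_derivative.
Context {R : realType}.
Implicit Types (F G : R -> R[i]) (u : R).

(** Componentwise, like [cintegral], so that the real fundamental theorem of calculus applies to
    each part. *)
Definition is_cderive u F (dF : R[i]) :=
  is_derive u 1 (fun v => complex.Re (F v)) (complex.Re dF) /\
  is_derive u 1 (fun v => complex.Im (F v)) (complex.Im dF).

Lemma is_cderive_eq u F dF dG : is_cderive u F dF -> dF = dG -> is_cderive u F dG.
Proof. by move=> ? <-. Qed.

Lemma is_cderive_cst u (c : R[i]) : is_cderive u (fun=> c) 0.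
Proof. by split; exact: is_derive_cst. Qed.

Lemma is_cderive_real u (f : R -> R) (df : R) : is_derive u 1 f df ->
  is_cderive u (fun v => (f v)%:C) df%:C.
Proof. by move=> h; split => //=; exact: is_derive_cst. Qed.

Lemma is_cderiveD u F G dF dG : is_cderive u F dF -> is_cderive u G dG ->
  is_cderive u (fun v => F v + G v) (dF + dG).
Proof.
move=> [f1 f2] [g1 g2]; split.
  by under eq_fun do rewrite cReD; rewrite cReD; exact: is_deriveD.
by under eq_fun do rewrite cImD; rewrite cImD; exact: is_deriveD.
Qed.

Lemma is_cderiveM u F G dF dG : is_cderive u F dF -> is_cderive u G dG ->
  is_cderive u (fun v => F v * G v) (F u * dG + G u * dF).
Proof.
move=> [f1 f2] [g1 g2]; split.
  under eq_fun do rewrite cReM.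
  apply: (is_derive_eq (is_deriveB (is_deriveM f1 g1) (is_deriveM f2 g2))).
  by rewrite cReD !cReM /GRing.scale /=; ring.
under eq_fun do rewrite cImM.
apply: (is_derive_eq (is_deriveD (is_deriveM f1 g2) (is_deriveM f2 g1))).
by rewrite cImD !cImM /GRing.scale /=; ring.
Qed.

Lemma sqrReIm_eq0 (z : R[i]) :
  (complex.Re z ^+ 2 + complex.Im z ^+ 2 == 0) = (z == 0).
Proof.
by case: z => x y; rewrite paddr_eq0 ?sqr_ge0//= !sqrf_eq0 eq_complex.
Qed.

Lemma is_cderiveV u F dF : F u != 0 -> is_cderive u F dF ->
  is_cderive u (fun v => (F v)^-1) (- dF / F u ^+ 2).
Proof.
move=> F0 [f1 f2].
have N0 : complex.Re (F u) ^+ 2 + complex.Im (F u) ^+ 2 != 0 by rewrite sqrReIm_eq0.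
have dN := is_deriveV (f := (fun v => complex.Re (F v)) ^+ 2 +
  (fun v => complex.Im (F v)) ^+ 2) N0
  (is_deriveD (is_deriveX 2 f1) (is_deriveX 2 f2)).
have F2 : F u ^+ 2 != 0 by rewrite expf_neq0.
have E : - dF / F u ^+ 2 = - dF * ((F u)^-1 * (F u)^-1) by rewrite expr2 invfM.
split.
  under eq_fun do rewrite cReV.
  apply: (is_derive_eq (is_deriveM f1 dN)).
  rewrite E !(cReM, cImM, cReV, cImV, raddfN) /=.
  rewrite /GRing.scale /= !fctE expr1.
  by case: dF {f1 f2 dN E} => p q /=; field.
under eq_fun do rewrite cImV.
apply: (is_derive_eq (is_deriveM (is_deriveN f2) dN)).
rewrite E !(cReM, cImM, cReV, cImV, raddfN) /=.
rewrite /GRing.scale /= !fctE expr1.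
by case: dF {f1 f2 dN E} => p q /=; field.
Qed.

Lemma is_cderive_id u : is_cderive u (fun v => v%:C) 1.
Proof. exact: is_cderive_real. Qed.

Lemma is_cderive_poly u (p : {poly R[i]}) :
  is_cderive u (fun v => p.[v%:C]) p^`().[u%:C].
Proof.
elim/poly_ind: p => [|p c IH].
  rewrite deriv0 horner0; under eq_fun do rewrite horner0.
  exact: is_cderive_cst.
under eq_fun do rewrite hornerMXaddC.
apply: (is_cderive_eq (is_cderiveD (is_cderiveM IH (is_cderive_id u))
  (is_cderive_cst u c))).
by rewrite derivD derivM derivX derivC !hornerE /=; ring.
Qed.

Lemma is_cderive_cpow u (a : R[i]) : 0 < u ->
  is_cderive u (fun v => cpow v a) (cpow u a * (a / u%:C)).
Proof.
move=> u0; have uC := realC_neq0 u0.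
have dln := is_derive1_ln u0.
have dl : is_derive u 1 (fun v => complex.Im a * ln v) (complex.Im a / u).
  by apply: (is_derive_eq (is_deriveZ (complex.Im a) dln)).
have dcos := is_derive1_comp (g := fun v => complex.Im a * ln v)
  (is_derive_cos (complex.Im a * ln u)) dl.
have dsin := is_derive1_comp (g := fun v => complex.Im a * ln v)
  (is_derive_sin (complex.Im a * ln u)) dl.
have dpow := is_derive1_powR (complex.Re a) u0.
have dcs : is_cderive u
    (fun v => cos (complex.Im a * ln v) +i* sin (complex.Im a * ln v))
    ((- sin (complex.Im a * ln u) * (complex.Im a / u)) +i*
     (cos (complex.Im a * ln u) * (complex.Im a / u))) by [].
apply: (is_cderive_eq (is_cderiveM (is_cderive_real dpow) dcs)).
have un0 : u != 0 by rewrite gt_eqF.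
have -> : u `^ (complex.Re a - 1) = u `^ complex.Re a / u.
  by rewrite powRB ?un0 ?implybT// powRr1// ltW.
rewrite /cpow.
case: a {dl dcos dsin dpow dcs} => ar ai /=.
set c := cos _; set s := sin _; set w := _ `^ _.
by apply/eqP; rewrite eq_complex !(cReD, cImD, cReM, cImM, cReV, cImV) /=;
  apply/andP; split; apply/eqP; field.
Qed.

(** Differentiability of [F'] is asked for only as a convenient source of its continuity on the
    closed interval. *)
Lemma cintegral_FTC2 (a b : R) F F' : a < b ->
  (forall u, a <= u <= b -> is_cderive u F (F' u)) ->
  (forall u, a <= u <= b -> exists d, is_cderive u F' d) ->
  cintegral (@lebesgue_measure R) `[a, b]%classic F' = F b - F a.
Proof.
move=> ab dF dF'.
have FTC (f f' : R -> R) : (forall u, a <= u <= b -> is_derive u 1 f (f' u)) ->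
    (forall u, a <= u <= b -> derivable f' u 1) ->
    \int[@lebesgue_measure R]_(u in `[a, b]%classic) f' u = f b - f a.
  move=> df df'; rewrite /Rintegral (@continuous_FTC2 _ f' f)//.
  - apply: derivable_within_continuous => u; rewrite in_itv/=; exact: df'.
  - have cf u : a <= u <= b -> {for u, continuous f}.
      move=> /df[h _]; apply/differentiable_continuous.
      exact/derivable1_diffP.
    split.
    + move=> u; rewrite in_itv/= => /andP[au ub].
      by have [] := df u; rewrite ?ltW.
    + by apply: cvg_at_right_filter; apply: cf; rewrite lexx ltW.
    + by apply: cvg_at_left_filter; apply: cf; rewrite lexx ltW.
  - move=> u; rewrite in_itv/= => /andP[au ub].
    by rewrite derive1E; have [] := df u; rewrite ?ltW.
have E1 := FTC (fun v => complex.Re (F v)) (fun v => complex.Re (F' v))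
  (fun u h => (dF u h).1) (fun u h => let: ex_intro _ d := dF' u h in
    ex_derive (is_derive := d.1)).
have E2 := FTC (fun v => complex.Im (F v)) (fun v => complex.Im (F' v))
  (fun u h => (dF u h).2) (fun u h => let: ex_intro _ d := dF' u h in
    ex_derive (is_derive := d.2)).
rewrite /cintegral E1 E2.
by case: (F b) => ? ?; case: (F a).
Qed.

End complex_valued_derivative.

(** * Exhaustion of the half-line by compact intervals *)

Section exhaustion.
Context {R : realType}.
Local Notation mu := (@lebesgue_measure R).
Local Notation H := (@halfline R).

(** Dominated convergence with dominating function |f|. The intervals stay away from 0 as well as
    from infinity, because the integrands may be singular at 0. *)
Lemma Rintegral_exhaust (f : R -> R) : mu.-integrable H (EFin \o f) ->
  \int[mu]_(u in `[k.+1%:R^-1, k.+1%:R]%classic) f u @[k --> \oo] -->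
  \int[mu]_(u in H) f u.
Proof.
move=> if_; pose E k := `[k.+1%:R^-1, k.+1%:R : R]%classic.
have mE k : measurable (E k : set (measurableTypeR R)) by exact: measurable_itv.
have EH k : E k `<=` H.
  move=> u; rewrite halflineE /E /= in_itv/= => /andP[+ _].
  by apply: lt_le_trans; rewrite invr_gt0.
have Efin k : ((\int[mu]_(u in E k) f u)%:E =
    \int[mu]_(u in H) ((EFin \o f) \_ (E k)) u)%E.
  rewrite fineK; last first.
    apply: integrable_fin_num; first exact: mE.
    exact: (integrableS measurable_halfline (mE k) (EH k) if_).
  by rewrite -integral_mkcondr (setIidr (EH k)).
suff : (\int[mu]_(u in E k) f u)%:E @[k --> \oo] --> (\int[mu]_(u in H) f u)%:E.
  by move/fine_cvgP => [_]; apply.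
rewrite fineK; last by apply: (integrable_fin_num measurable_halfline).
under eq_fun do rewrite Efin.
have [||||| _ _] := @dominated_convergence _ _ _ mu H measurable_halfline
  (fun k => (EFin \o f) \_ (E k)) (EFin \o f) (abse \o (EFin \o f)); last exact.
- move=> k; apply: (measurable_funS measurableT) => //.
  apply/(measurable_restrictT _ (mE k)).
  exact: (measurable_funS measurable_halfline (EH k) (measurable_int _ if_)).
- exact: measurable_int if_.
- apply: aeW => u; rewrite halflineE => u0.
  apply: cvg_near_cst; near=> k.
  rewrite /patch mem_set// /E /= in_itv/=; apply/andP; split.
    rewrite -[leRHS]invrK lef_pV2 ?posrE ?invr_gt0//.
    rewrite (@le_trans _ _ k%:R)// ?ler_nat//.
    near: k; apply: nbhs_infty_ger.
  rewrite (@le_trans _ _ k%:R)// ?ler_nat//.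
  near: k; apply: nbhs_infty_ger.
- exact: integrable_abse if_.
- apply: aeW => u k _; rewrite /patch; case: ifPn => _; first exact: lexx.
  by rewrite /point /= normr0 lee_fin.
Unshelve. all: by end_near. Qed.

(** The integrals over the compact intervals are prescribed only for large [k], since a fixed point
    such as the jump lies inside the interval only from some [k] on. *)
Lemma cintegral_exhaust (f : R -> R[i]) (c : nat -> R[i]) (l : R[i]) :
  cintegrable mu H f ->
  (\forall k \near \oo,
    cintegral mu `[k.+1%:R^-1, k.+1%:R]%classic f = c k) ->
  norm1 (c k - l) @[k --> \oo] --> 0 -> cintegral mu H f = l.
Proof.
move=> [f1 f2] fc cl.
have lim (r : R[i] -> R) (y : R) : {morph r : z w / z - w} ->
    (forall z, `|r z| <= norm1 z) ->
    r (cintegral mu `[k.+1%:R^-1, k.+1%:R]%classic f) @[k --> \oo] --> y ->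
    y = r l.
  move=> rB r1 cy; have : r (c k) @[k --> \oo] --> y.
    apply: cvg_trans cy; apply: near_eq_cvg; near=> k.
    by congr r; near: k; exact: fc.
  move=> h; apply: (cvg_unique _ h) => //.
  apply/subr_cvg0/norm_cvg0P.
  apply: (@squeeze_cvgr _ _ _ _ (fun=> 0) (fun k => norm1 (c k - l))) => //.
    by near=> k; rewrite normr_ge0 /= -rB r1.
  exact: cvg_cst.
rewrite [RHS](_ : l = complex.Re l +i* complex.Im l); last by case: l cl lim.
rewrite /cintegral; congr (_ +i* _).
  apply: (lim (@complex.Re R)).
  - by move=> [? ?] [? ?].
  - exact: Re_le_norm1.
  - exact: (Rintegral_exhaust f1).
apply: (lim (@complex.Im R)).
- by move=> [? ?] [? ?].
- exact: Im_le_norm1.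
- exact: (Rintegral_exhaust f2).
Unshelve. all: by end_near. Qed.

Lemma cintegral_itv_obnd_cbnd (a b : R) (f : R -> R[i]) :
  cmeasurable `]a, b]%classic f ->
  cintegral mu `]a, b]%classic f = cintegral mu `[a, b]%classic f.
Proof.
move=> [f1 f2]; rewrite /cintegral /Rintegral; congr (_ +i* _); congr fine;
  by apply: integral_itv_obnd_cbnd; exact/measurable_EFinP.
Qed.

End exhaustion.

(** * The weights: moments, Cauchy kernels and integration by parts *)

Section weights.
Context {R : realType}.
Local Notation mu := (@lebesgue_measure R).
Local Notation H := (@halfline R).
Implicit Types (w : R -> R[i]) (p f g : {poly R[i]}) (x z : R[i]).

(** The one-variable integrability on which every Cauchy transform rests; for the weights of the
    theorem it is derived in [has_moments_right]. *)
Definition has_moments w :=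
  cmeasurable setT w /\ forall j, cintegrable mu H (fun u => w u * u%:C ^+ j).

Lemma cmeasurableS (D : set R) (F : R -> R[i]) : measurable D ->
  cmeasurable (setT : set R) F -> cmeasurable D F.
Proof. by move=> mD [? ?]; split; exact: measurable_funTS. Qed.

Lemma cmeasurable_cpow (a : R[i]) : cmeasurable setT (fun u : R => cpow u a).
Proof.
apply: cmeasurableM; first by apply: cmeasurable_real; exact: measurable_powR.
have ml : measurable_fun setT (fun u : R => complex.Im a * ln u).
  by apply: measurable_funM => //; exact: measurable_ln.
split => /=.
  apply: (measurableT_comp (continuous_measurable_fun _) ml).
  exact: continuous_cos.
apply: (measurableT_comp (continuous_measurable_fun _) ml).
exact: continuous_sin.
Qed.

Lemma cmeasurable_weight (a xi : R[i]) (s : R) : cmeasurable setT (weight a xi s).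
Proof.
apply: cmeasurableM; last first.
  apply: cmeasurable_real; apply: (measurableT_comp (@measurable_expR R)) => //.
apply: cmeasurableM; last exact: cmeasurable_cpow.
have m1 : cmeasurable setT (fun u : R => 1 - (\1_(`]s, +oo[%classic) u)%:C * xi).
  apply: cmeasurableB; first exact: cmeasurable_cst.
  apply: cmeasurableM; last exact: cmeasurable_cst.
  apply: cmeasurable_real; apply: measurable_indic; exact: measurable_itv.
rewrite (_ : (fun u => _) =
  (fun u : R => 1 - (\1_(`]s, +oo[%classic) u)%:C * xi)) //.
apply/funext => u; rewrite indicE; congr (1 - _).
case: ifPn => su; first by rewrite mem_set ?mul1r//= in_itv/= su.
by rewrite memNset ?mul0r//= in_itv/= andbT; exact/negP.
Qed.

(** The bound is |Im x| off the real axis and -x on the negative axis. Being uniform in [u], it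
    bounds the Cauchy kernel over the whole half-line. *)
Lemma cut_plane_dist x : cut_plane x ->
  exists2 e : R, 0 < e & forall u, 0 <= u -> e <= norm1 (x - u%:C).
Proof.
case: x => x y; have [-> cx|y0 _] := eqVneq y 0.
  have x0 : x < 0.
    rewrite ltNge; apply/negP => x0; apply: cx; exists x => //=.
    by rewrite in_itv/= x0.
  exists (- x); rewrite ?oppr_gt0// => u u0.
  rewrite /norm1 /= subrr normr0 addr0 ler0_norm ?lerBlDr ?opprB ?subr_le0; lra.
exists `|y|; first by rewrite normr_gt0.
by move=> u u0; rewrite /norm1 /= subr0 lerDr.
Qed.

Lemma cut_plane_neq x u : cut_plane x -> 0 <= u -> x - u%:C != 0.
Proof.
move=> cx u0; rewrite subr_eq0; apply/eqP => xu; apply: cx; exists u => //=.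
by rewrite in_itv/= u0.
Qed.

Lemma cut_planeN (u : R) : 0 < u -> cut_plane (- u%:C).
Proof.
move=> u0 [r /=]; rewrite in_itv/= andbT => r0 [/eqP].
by rewrite -subr_eq0 opprK gt_eqF// ltr_wpDl.
Qed.

Lemma norm1X_le z (M : R) k : norm1 z <= M -> norm1 (z ^+ k) <= M ^+ k.
Proof.
move=> zM; elim: k => [|k IH].
  by rewrite !expr0 (norm1_real 1) normr1.
by rewrite !exprS (le_trans (norm1M _ _))// ler_pM ?norm1_ge0.
Qed.

Lemma cmeasurable_realC (D : set R) : cmeasurable D (fun u : R => u%:C).
Proof. by apply: cmeasurable_real; exact: measurable_id. Qed.

Lemma cintegrable_poly w p : has_moments w ->
  cintegrable mu H (fun u => w u * p.[u%:C]).
Proof.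
move=> [_ mw]; rewrite (_ : (fun u => _) =
    (fun u => \sum_(i < size p) p`_i * (w u * u%:C ^+ i))).
  apply: cintegrable_sum => [|i]; first exact: measurable_halfline.
  by apply: cintegrableZ; [exact: measurable_halfline|exact: mw].
apply/funext => u; rewrite horner_coef mulr_sumr; apply: eq_bigr => i _.
by rewrite mulrCA.
Qed.

Lemma cintegrable_cauchy w p x k : has_moments w -> cut_plane x ->
  cintegrable mu H (fun u => w u * p.[u%:C] * (x - u%:C)^-1 ^+ k).
Proof.
move=> mw /cut_plane_dist[e e0 xe].
apply: (@cintegrable_mulbnd _ _ _ mu H (fun u => w u * p.[u%:C])
  (fun u => (x - u%:C)^-1 ^+ k) ((2 / e) ^+ k)).
- exact: measurable_halfline.
- exact: cintegrable_poly.
- have m1 : cmeasurable H (fun u : R => (x - u%:C)^-1).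
    apply: cmeasurableV; apply: cmeasurableB; first exact: cmeasurable_cst.
    exact: cmeasurable_realC.
  elim: k => [|k IH].
    by under eq_fun do rewrite expr0; exact: cmeasurable_cst.
  by under eq_fun do rewrite exprS; exact: cmeasurableM.
- move=> u; rewrite halflineE => /ltW u0.
  by apply: norm1X_le; apply: norm1V_le => //; exact: xe.
Qed.

Lemma cintegrable_cauchy1 w p x : has_moments w -> cut_plane x ->
  cintegrable mu H (fun u => w u / (x - u%:C) * p.[u%:C]).
Proof.
move=> mw cx; have := cintegrable_cauchy p 1 mw cx.
by under eq_fun do rewrite expr1 mulrAC.
Qed.

Lemma cintegrable_cauchy2 w p x : has_moments w -> cut_plane x ->
  cintegrable mu H (fun u => w u * p.[u%:C] / (x - u%:C) ^+ 2).
Proof.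
move=> mw cx; have := cintegrable_cauchy p 2 mw cx.
by under eq_fun do rewrite exprVn.
Qed.

(** Powers of 1 + u rather than of u, so that a single bound is good both near 0 and near
    infinity. *)
Lemma norm1_horner_le p : exists C n, forall u : R, 0 <= u ->
  norm1 p.[u%:C] <= C * (1 + u) ^+ n.
Proof.
elim/poly_ind: p => [|p c [C [n IH]]].
  by exists 0, 0%N => u _; rewrite horner0 (norm1_real 0) normr0 mul0r.
exists (C + norm1 c), n.+1 => u u0; rewrite hornerMXaddC.
apply: (le_trans (norm1D _ _)); rewrite mulrDl; apply: lerD; last first.
  by rewrite ler_peMr ?norm1_ge0// exprn_ege1// lerDl.
apply: (le_trans (norm1M _ _)); rewrite exprSr mulrA.
apply: ler_pM; rewrite ?norm1_ge0 ?IH// norm1_real ger0_norm//.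
by rewrite lerDr.
Qed.

Lemma norm1_cpow_le (u : R) a : norm1 (cpow u a) <= u `^ complex.Re a * 2.
Proof.
apply: (le_trans (norm1M _ _)).
rewrite norm1_real ger0_norm ?powR_ge0// ler_wpM2l ?powR_ge0//.
rewrite /norm1 /=; set t := _ * _.
rewrite -[2](_ : 1 + 1 = 2 :> R)//; apply: lerD; rewrite ler_norml.
  by rewrite cos_geN1 cos_le1.
by rewrite sin_geN1 sin_le1.
Qed.

Lemma cpowD1 (u : R) a : 0 < u -> cpow u (a + 1) = u%:C * cpow u a.
Proof.
move=> u0; rewrite /cpow cReD cImD /= addr0.
rewrite powRD; last by rewrite (gt_eqF u0) implybT.
by rewrite powRr1 ?(ltW u0)// [_ * u]mulrC rmorphM mulrA.
Qed.

Section primitive.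
Variables (a : R[i]) (x : R[i]) (p : {poly R[i]}).
Hypotheses (cx : cut_plane x).

(** This is u^(a+1) e^(-u) p(u)/(x-u). The factor 1 - xi is left out, so that [F] is smooth across
    [s], and the explicit factor [u] cancels the a/u that comes from differentiating [cpow u a]. *)
Let F (u : R) : R[i] :=
  cpow u a * (expR (- u))%:C * (u%:C * p.[u%:C] * (x - u%:C)^-1).

Let g (u : R) : R[i] :=
  ((1 + a - u%:C) * p.[u%:C] + u%:C * p^`().[u%:C]) * (x - u%:C)^-1 +
  u%:C * p.[u%:C] * ((x - u%:C)^-1 * (x - u%:C)^-1).

Let is_cderive_expN (u : R) :
  is_cderive u (fun v => (expR (- v))%:C) (- (expR (- u))%:C).
Proof.
have h : is_derive u 1 (fun v : R => expR (- v)) (- expR (- u)).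
  apply: (is_derive_eq (is_derive1_comp (g := fun v : R => - v)
    (is_derive_expR (- u)) (is_deriveNid u 1))).
  by rewrite mulrN1.
by apply: (is_cderive_eq (is_cderive_real h)); rewrite raddfN.
Qed.

Let is_cderive_resolvent (u : R) : 0 < u ->
  is_cderive u (fun v => (x - v%:C)^-1) ((x - u%:C)^-1 * (x - u%:C)^-1).
Proof.
move=> u0; have := is_cderiveV (F := fun v => x + -1 * v%:C) _
  (is_cderiveD (is_cderive_cst u x)
    (is_cderiveM (is_cderive_cst u (-1)) (is_cderive_id u))).
under eq_fun do rewrite mulN1r; rewrite mulN1r.
move=> /(_ (cut_plane_neq cx (ltW u0))) h.
apply: (is_cderive_eq h).
by field; exact: cut_plane_neq cx (ltW u0).
Qed.

Lemma is_cderive_primitive (u : R) : 0 < u ->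
  is_cderive u F (cpow u a * (expR (- u))%:C * g u).
Proof.
move=> u0; have xu := cut_plane_neq cx (ltW u0).
have uC := realC_neq0 u0.
apply: (is_cderive_eq (is_cderiveM
  (is_cderiveM (is_cderive_cpow a u0) (is_cderive_expN u))
  (is_cderiveM (is_cderiveM (is_cderive_id u) (is_cderive_poly u p))
    (is_cderive_resolvent u0)))).
by rewrite /g; field; rewrite ?xu ?uC.
Qed.

(** Only existence matters, as it supplies the continuity of the integrand in [cintegral_FTC2]. *)
Lemma cderivable_derivative (u : R) : 0 < u ->
  exists d, is_cderive u (fun v => cpow v a * (expR (- v))%:C * g v) d.
Proof.
move=> u0; have dr := is_cderive_resolvent u0.
have dp := is_cderive_poly u; have did := is_cderive_id u.
have := is_cderiveD (is_cderive_cst u (1 + a))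
  (is_cderiveM (is_cderive_cst u (-1)) did).
under eq_fun do rewrite mulN1r; move=> dB.
eexists; rewrite /g; apply: is_cderiveM.
  by apply: is_cderiveM; [exact: is_cderive_cpow|exact: is_cderive_expN].
apply: is_cderiveD.
  apply: is_cderiveM; last exact: dr.
  apply: is_cderiveD; first exact: is_cderiveM dB (dp p).
  exact: is_cderiveM did (dp _).
by apply: is_cderiveM; [exact: is_cderiveM did (dp _)|exact: (is_cderiveM dr dr)].
Qed.

Let cmeasurable_derivative :
  cmeasurable setT (fun v : R => cpow v a * (expR (- v))%:C * g v).
Proof.
have mid := cmeasurable_realC setT; have mc := @cmeasurable_cst _ R R setT.
have mr : cmeasurable setT (fun v : R => (x - v%:C)^-1).
  by apply: cmeasurableV; exact: cmeasurableB.
have mp q : cmeasurable setT (fun v : R => q.[v%:C]) by exact: cmeasurable_horner.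
apply: cmeasurableM.
  apply: cmeasurableM; first exact: cmeasurable_cpow.
  by apply: cmeasurable_real; exact: measurableT_comp.
apply: cmeasurableD.
  apply: cmeasurableM mr; apply: cmeasurableD; last exact: cmeasurableM.
  by apply: cmeasurableM => //; exact: cmeasurableB.
by apply: cmeasurableM; exact: cmeasurableM.
Qed.

Lemma norm1_primitive_le : exists C n, forall u : R, 0 < u ->
  norm1 (F u) <= C * (u `^ (complex.Re a + 1) * (1 + u) ^+ n * expR (- u)).
Proof.
have [e e0 xe] := cut_plane_dist cx.
have [C [n pC]] := norm1_horner_le p.
exists (2 * C * (2 / e)), n => u u0.
rewrite powRD; last by rewrite (gt_eqF u0) implybT.
rewrite powRr1 ?(ltW u0)//.
have h1 : norm1 (cpow u a * (expR (- u))%:C) <=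
    u `^ complex.Re a * 2 * expR (- u).
  apply: (le_trans (norm1M _ _)); rewrite norm1_real (ger0_norm (expR_ge0 _)).
  by rewrite ler_wpM2r ?expR_ge0 ?norm1_cpow_le.
have h2 : norm1 (u%:C * p.[u%:C] * (x - u%:C)^-1) <=
    u * (C * (1 + u) ^+ n) * (2 / e).
  apply: (le_trans (norm1M _ _)); apply: ler_pM; rewrite ?norm1_ge0//.
    apply: (le_trans (norm1M _ _)); rewrite norm1_real ger0_norm ?(ltW u0)//.
    by rewrite ler_wpM2l ?(ltW u0) ?pC ?(ltW u0).
  by apply: norm1V_le => //; apply: xe; exact: ltW.
apply: (le_trans (norm1M _ _)).
apply: (le_trans (ler_pM (norm1_ge0 _) (norm1_ge0 _) h1 h2)).
rewrite le_eqVlt; apply/orP; left; apply/eqP; ring.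
Qed.

Lemma primitive_cvg0 : -1 < complex.Re a -> norm1 (F k.+1%:R^-1) @[k --> \oo] --> 0.
Proof.
move=> a1; have [C [n FC]] := norm1_primitive_le.
have a10 : 0 < complex.Re a + 1 by lra.
(* The limit of [powR] at 0 is one-sided, so the points have to approach 0 through positive
   values. *)
have h0 : k.+1%:R^-1 @[k --> \oo] --> (0 : R)^'+.
  move=> A [e /= e0 eA]; have := @cvg_harmonic R.
  move/cvgr0Pnorm_lt => /(_ e e0) he.
  change (\forall k \near \oo, A (k.+1%:R^-1 : R)); near=> k.
  apply: eA => /=; last by rewrite invr_gt0.
  by rewrite sub0r normrN; near: k; exact: he.
apply: (@squeeze_cvgr _ _ _ _ (fun=> 0)
  (fun k => `|C| * 2 ^+ n * ((k.+1%:R^-1) `^ (complex.Re a + 1)))); last 2 first.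
- exact: cvg_cst.
- rewrite -[X in _ --> X](mulr0 (`|C| * 2 ^+ n)).
  apply: cvgMr; exact: (cvg_comp _ _ h0 (powR_cvg0 a10)).
near=> k; rewrite norm1_ge0 /=.
have k0 : 0 < k.+1%:R^-1 :> R by rewrite invr_gt0.
have k1 : k.+1%:R^-1 <= 1 :> R by rewrite invf_le1// ler1n.
apply: (le_trans (FC _ k0)); rewrite -!mulrA.
apply: (@le_trans _ _ (`|C| * ((k.+1%:R^-1) `^ (complex.Re a + 1) *
    ((1 + k.+1%:R^-1) ^+ n * expR (- k.+1%:R^-1))))).
  by rewrite ler_wpM2r ?ler_norm ?mulr_ge0 ?powR_ge0 ?expR_ge0 ?exprn_ge0
    ?addr_ge0 ?(ltW k0).
rewrite ler_wpM2l// mulrC ler_wpM2r ?powR_ge0//.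
rewrite -[leRHS]mulr1; apply: ler_pM; rewrite ?expR_ge0//.
apply: lerXn2r; rewrite ?nnegrE ?addr_ge0 ?(ltW k0)//.
by rewrite -[2]/(1 + 1) lerD2l.
Unshelve. all: by end_near. Qed.

Lemma primitive_cvgy : norm1 (F k.+1%:R) @[k --> \oo] --> 0.
Proof.
have [C [n FC]] := norm1_primitive_le.
have [m am] : exists m : nat, complex.Re a + 1 <= m%:R.
  exists (Num.truncn (`|complex.Re a + 1|)).+1; apply: (le_trans (ler_norm _)).
  by rewrite ltW// truncnS_gt.
pose N := (m + n)%N.
apply: (@squeeze_cvgr _ _ _ _ (fun=> 0)
  (fun k => `|C| * 2 ^+ n * N.+1`!%:R * k.+1%:R^-1)); last 2 first.
- exact: cvg_cst.
- rewrite -[X in _ --> X](mulr0 (`|C| * 2 ^+ n * N.+1`!%:R)).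
  by apply: cvgMr; exact: cvg_harmonic.
near=> k; rewrite norm1_ge0 /=; set u : R := k.+1%:R.
have u0 : 0 < u by rewrite ltr0n.
have u1 : 1 <= u by rewrite ler1n.
(* A single term of the exponential series, u^(N+1)/(N+1)! <= e^u, already gives decay like 1/u. *)
have hexp : u ^+ N * expR (- u) <= N.+1`!%:R / u.
  rewrite expRN ler_pdivlMr// mulrAC -exprSr ler_pdivrMr ?expR_gt0//.
  have := expR_ge1Dxn N (ltW u0); set f : R := N.+1`!%:R => h.
  have f0 : 0 < f by rewrite ltr0n fact_gt0.
  have : u ^+ N.+1 / f <= expR u by apply: le_trans h; rewrite lerDr.
  by rewrite ler_pdivrMr// mulrC.
apply: (le_trans (FC _ u0)).
(* Since u >= 1, the real exponent may be raised to the integer [m], and 1 + u <= 2u. *)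
apply: (@le_trans _ _ (`|C| * (u ^+ m * (2 * u) ^+ n * expR (- u)))).
  apply: (@le_trans _ _
      (`|C| * (u `^ (complex.Re a + 1) * (1 + u) ^+ n * expR (- u)))).
    by rewrite ler_wpM2r ?ler_norm ?mulr_ge0 ?powR_ge0 ?expR_ge0 ?exprn_ge0
      ?addr_ge0 ?(ltW u0).
  rewrite ler_wpM2l// ler_wpM2r ?expR_ge0//; apply: ler_pM.
  - exact: powR_ge0.
  - by rewrite exprn_ge0// addr_ge0// ltW.
  - by rewrite -powR_mulrn ?(ltW u0)//; exact: ler_powR.
  - apply: lerXn2r; rewrite ?nnegrE ?addr_ge0 ?mulr_ge0 ?(ltW u0)//.
    by rewrite [2 * u]mulr_natl mulr2n lerD2r.
rewrite exprMn -!mulrA ler_wpM2l//.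
rewrite mulrCA ler_wpM2l ?exprn_ge0// mulrA -exprD.
exact: hexp.
Unshelve. all: by end_near. Qed.

(** On the two sides of [s] the integrand is the derivative of [F] and of (1 - xi) F. The outer
    boundary terms tend to 0, and the inner ones leave F(s) - (1 - xi) F(s). *)
Lemma cintegral_by_parts (xi : R[i]) (s : R) :
  -1 < complex.Re a -> 0 < s -> has_moments (weight a xi s) ->
  cintegral mu H (fun u => weight a xi s u *
    (((1 + a - u%:C) * p.[u%:C] + u%:C * p^`().[u%:C]) / (x - u%:C) +
     u%:C * p.[u%:C] / (x - u%:C) ^+ 2)) =
  xi * cpow s (a + 1) * (expR (- s))%:C * (p.[s%:C] / (x - s%:C)).
Proof.
move=> a1 s0 mw; set w := weight a xi s.
have gE u : ((1 + a - u%:C) * p.[u%:C] + u%:C * p^`().[u%:C]) / (x - u%:C) +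
     u%:C * p.[u%:C] / (x - u%:C) ^+ 2 = g u by rewrite expr2 invfM.
have Fs : xi * cpow s (a + 1) * (expR (- s))%:C * (p.[s%:C] / (x - s%:C)) = xi * F s.
  by rewrite cpowD1// /F; ring.
rewrite Fs.
set I := (fun u => w u * _).
have iI : cintegrable mu H I.
  pose q := (1 + a)%:P * p - 'X * p + 'X * p^`().
  apply: (@eq_cintegrable _ _ _ mu H (fun u => w u / (x - u%:C) * q.[u%:C] +
    w u * ('X * p).[u%:C] / (x - u%:C) ^+ 2)).
  - exact: measurable_halfline.
  - move=> u _; rewrite /q !(hornerD, hornerN, hornerM, hornerX, hornerC) /I.
    by ring.
  - apply: cintegrableD; first exact: measurable_halfline.
      exact: cintegrable_cauchy1.
    exact: cintegrable_cauchy2.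
apply: (@cintegral_exhaust _ _ (fun k =>
  F s - F k.+1%:R^-1 + ((1 - xi) * F k.+1%:R - (1 - xi) * F s)) _ iI).
- near=> k; set lo : R := k.+1%:R^-1; set hi : R := k.+1%:R.
  have lo0 : 0 < lo by rewrite invr_gt0.
  have los : lo < s.
    rewrite -[s]invrK /lo ltf_pV2 ?posrE ?invr_gt0//.
    rewrite (@lt_trans _ _ k%:R)// ?ltr_nat//.
    near: k; exact: nbhs_infty_gtr.
  have shi : s < hi.
    rewrite (@lt_trans _ _ k%:R)// ?ltr_nat//.
    near: k; exact: nbhs_infty_gtr.
  have splitE : `[lo, hi]%classic = `[lo, s]%classic `|` `]s, hi]%classic :> set R.
    by rewrite -itv_bndbnd_setU// bnd_simp ltW.
  rewrite splitE cintegral_setU; first last.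
  + apply/disj_setPS => u [/=]; rewrite !in_itv/= => /andP[_ us] /andP[su _].
    by move: us; rewrite leNgt su.
  + rewrite -splitE; apply: (cintegrableS measurable_halfline _ _ iI).
      exact: measurable_itv.
    move=> u; rewrite halflineE /= in_itv/= => /andP[+ _].
    exact: lt_le_trans.
  + exact: measurable_itv.
  + exact: measurable_itv.
  congr (_ + _).
    rewrite -(cintegral_FTC2 (F := F)
      (F' := fun v => cpow v a * (expR (- v))%:C * g v) los).
    * apply: eq_cintegral => u /set_mem; rewrite /= in_itv/= => /andP[_ us].
      by rewrite /I gE /w /weight ltNge us /= subr0 mul1r.
    * by move=> u /andP[lou _]; apply: is_cderive_primitive; exact: lt_le_trans lou.
    * by move=> u /andP[lou _]; apply: cderivable_derivative; exact: lt_le_trans lou.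
  rewrite -(cintegral_FTC2 (F := fun v => (1 - xi) * F v)
      (F' := fun v => (1 - xi) * (cpow v a * (expR (- v))%:C * g v)) shi).
  (* The weight keeps its left value at [s], so the right piece is open there; the closed interval
     of the fundamental theorem differs from it by a null set. *)
  + rewrite -cintegral_itv_obnd_cbnd; last first.
      apply: cmeasurableS; first exact: measurable_itv.
      exact: cmeasurableM (cmeasurable_cst _ _) cmeasurable_derivative.
    apply: eq_cintegral => u /set_mem; rewrite /= in_itv/= => /andP[su _].
    by rewrite /I gE /w /weight su !mulrA.
  + move=> u /andP[su _].
    apply: (is_cderive_eq (is_cderiveM (is_cderive_cst u (1 - xi))
      (is_cderive_primitive (lt_le_trans s0 su)))).
    by rewrite mulr0 addr0.
  + move=> u /andP[su _].
    have [d hd] := cderivable_derivative (lt_le_trans s0 su).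
    by eexists; exact: is_cderiveM (is_cderive_cst u (1 - xi)) hd.
- apply: (@squeeze_cvgr _ _ _ _ (fun=> 0)
    (fun k => norm1 (F k.+1%:R^-1) + norm1 (1 - xi) * norm1 (F k.+1%:R)));
    last 2 first.
  + exact: cvg_cst.
  + rewrite -[X in _ --> X](addr0 0); apply: cvgD; first exact: primitive_cvg0.
    rewrite -[X in _ --> X](mulr0 (norm1 (1 - xi))).
    by apply: cvgMr; exact: primitive_cvgy.
  + near=> k; rewrite norm1_ge0 /=.
    have -> : F s - F k.+1%:R^-1 + ((1 - xi) * F k.+1%:R - (1 - xi) * F s) -
      xi * F s = - F k.+1%:R^-1 + (1 - xi) * F k.+1%:R by ring.
    apply: (le_trans (norm1D _ _)); rewrite norm1N lerD2l.
    exact: norm1M.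
Unshelve. all: by end_near. Qed.

End primitive.

End weights.

(** * Cauchy transforms: linearity, multiplication by X, complex derivative *)

Section cauchy_transform.
Context {R : realType}.
Local Notation mu := (@lebesgue_measure R).
Local Notation H := (@halfline R).
Local Notation mH := (@measurable_halfline R).
Implicit Types (f g : {poly R[i]}) (x z c : R[i]).

Variable w : R -> R[i].
Hypothesis mw : has_moments w.

Lemma assocD f g x : cut_plane x -> assoc w (f + g) x = assoc w f x + assoc w g x.
Proof.
move=> cx; rewrite /assoc -cintegralD; [|exact: mH|exact: cintegrable_cauchy1..].
by apply: eq_cintegral => u _; rewrite hornerD mulrDr.
Qed.

Lemma assocZ c f x : cut_plane x -> assoc w (c *: f) x = c * assoc w f x.
Proof.
move=> cx; rewrite /assoc -cintegralZ; [|exact: mH|exact: cintegrable_cauchy1].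
by apply: eq_cintegral => u _; rewrite hornerZ mulrCA.
Qed.

Lemma assocN f x : cut_plane x -> assoc w (- f) x = - assoc w f x.
Proof. by move=> cx; rewrite -scaleN1r assocZ// mulN1r. Qed.

(** From u/(x-u) = x/(x-u) - 1. *)
Lemma assocXM f x : cut_plane x ->
  assoc w ('X * f) x = x * assoc w f x - wint w f.
Proof.
move=> cx; rewrite /assoc /wint -cintegralZ; [|exact: mH|exact: cintegrable_cauchy1].
rewrite -mulN1r -cintegralZ; [|exact: mH|exact: cintegrable_poly].
rewrite -cintegralD; first last.
- by apply: cintegrableZ; [exact: mH|exact: cintegrable_poly].
- by apply: cintegrableZ; [exact: mH|exact: cintegrable_cauchy1].
- exact: mH.
apply: eq_cintegral => u /set_mem; rewrite halflineE => /ltW u0.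
have xu := cut_plane_neq cx u0.
by rewrite hornerM hornerX; field.
Qed.

(** Complex limits are measured by the modulus, the estimates here by [norm1]; together with
    [norm_le_norm1] this allows passage in both directions. The imaginary part is bounded as the
    real part of -i z. *)
Lemma norm1_le_norm (z : R[i]) : (norm1 z)%:C <= 2 * `|z|.
Proof.
rewrite /norm1 rmorphD mulr_natl mulr2n; apply: lerD; first exact: normc_ge_Re.
have := normc_ge_Re (z * -'i%C).
rewrite normrM normrN (_ : `|'i%C : R[i]| = 1); last first.
  by rewrite normc_def /= expr0n add0r expr1n sqrtr1.
rewrite mulr1 mulrN; case: z => p q /=.
by rewrite !(mul0r, mulr1, mulr0, sub0r, opprK).
Qed.

(** Instead of differentiating under the integral sign, the proof integrates the exact identity
    1/(x+h-u) = 1/(x-u) - h/(x-u)^2 + h^2/((x-u)^2 (x+h-u)) and bounds the last term uniformly in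
    [h]. With [R[i]^o] the increment [h] is complex, so this is the complex derivative. *)
Lemma is_derive_assoc f (x : R[i]^o) : cut_plane x ->
  is_derive x (1 : R[i]^o) (assoc w f : R[i]^o -> R[i]^o)
    (- cintegral mu H (fun u => w u * f.[u%:C] / (x - u%:C) ^+ 2)).
Proof.
move=> cx; set D := cintegral _ _ _.
have [e e0 xe] := cut_plane_dist cx.
pose K h u := w u * f.[u%:C] / (x - u%:C) ^+ 2 * (x + h - u%:C)^-1.
(* For [norm1 h <= e / 2] the point x + h keeps distance e/2 from the half-line, and [norm1V_le]
   then gives 2/(e/2) = 4/e. *)
pose M := \int[mu]_(u in H) ((4 / e) * (norm1 (w u * f.[u%:C] / (x - u%:C) ^+ 2))).
have M0 : 0 <= M.
  by apply: Rintegral_ge0 => u _; rewrite mulr_ge0 ?norm1_ge0 ?divr_ge0 ?ltW.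
have iN := integrable_norm1 mH (cintegrable_cauchy2 f mw cx).
have main h : norm1 h <= e / 2 -> assoc w f (x + h) =
    assoc w f x - h * D + h ^+ 2 * cintegral mu H (K h) /\
    norm1 (cintegral mu H (K h)) <= M.
  move=> he.
  have xhe u : 0 <= u -> e / 2 <= norm1 (x + h - u%:C).
    move=> u0; have := xe u u0; have := norm1D (x + h - u%:C) (- h).
    rewrite norm1N (_ : x + h - u%:C - h = x - u%:C); last by ring.
    by move: he; lra.
  have e20 : 0 < e / 2 by rewrite divr_gt0.
  have cxh : cut_plane (x + h).
    move=> [r /=]; rewrite in_itv/= andbT => r0 rx; have := xhe r r0.
    by rewrite -rx subrr (norm1_real 0) normr0 leNgt e20.
  have Kb u : H u -> norm1 (x + h - u%:C)^-1 <= 4 / e.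
    rewrite halflineE => /ltW/xhe /(norm1V_le e20) /le_trans; apply.
    by rewrite le_eqVlt; apply/orP; left; apply/eqP; field; rewrite gt_eqF.
  have mK : cmeasurable H (fun u : R => (x + h - u%:C)^-1).
    apply: cmeasurableV; apply: cmeasurableB; first exact: cmeasurable_cst.
    exact: cmeasurable_realC.
  have iK : cintegrable mu H (K h).
    exact: (cintegrable_mulbnd mH (cintegrable_cauchy2 f mw cx) mK Kb).
  split; last first.
    apply: norm1_cintegral_le => //; first exact: mH.
      exact: (integrableZl mH (4 / e) iN).
    move=> u Hu; rewrite mulrC (le_trans (norm1M _ _))//.
    by rewrite ler_wpM2l ?norm1_ge0 ?Kb.
  have mH0 := mH; have i20 := cintegrable_cauchy2 f mw cx.
  rewrite /assoc -mulNr /D -!cintegralZ//.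
  have i2 := cintegrableZ (- h) mH (cintegrable_cauchy2 f mw cx).
  have i3 := cintegrableZ (h ^+ 2) mH iK.
  rewrite -cintegralD; [|exact: mH|exact: cintegrable_cauchy1|exact: i2].
  rewrite -cintegralD; [|exact: mH| |exact: i3]; last first.
    by apply: cintegrableD => //; exact: cintegrable_cauchy1.
  apply: eq_cintegral => u /set_mem; rewrite halflineE => /ltW u0.
  have xu := cut_plane_neq cx u0; have xhu := cut_plane_neq cxh u0.
  by rewrite /K; field; rewrite xu xhu.
pose q (h : R[i]^o) : R[i]^o := h^-1 *:
  ((assoc w f : R[i]^o -> R[i]^o) (h *: (1 : R[i]^o) + x) - assoc w f x).
have lim : q @ (0 : R[i]^o)^' --> (- D : R[i]^o).
  apply/(@cvgrPdist_le _ _ _ _ _ q) => eps eps0.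
  (* [M] may be 0, hence the division by M + 1. *)
  have M1 : 0 < (M + 1)%:C :> R[i] by rewrite ltcR ltr_wpDl.
  near=> h.
  have h0 : h != 0 by near: h; exact: nbhs_dnbhs_neq.
  (* Since [norm1 h] is at most twice the modulus, e/4 ensures the bound e/2 required by [main]. *)
  have hsmall : `|h| <= (e / 4)%:C.
    near: h; apply: dnbhs0_le; rewrite ltcR divr_gt0//.
  have heps : `|h| <= eps / (M + 1)%:C.
    by near: h; apply: dnbhs0_le; rewrite divr_gt0.
  have he : norm1 h <= e / 2.
    rewrite -lecR (le_trans (norm1_le_norm h))//.
    apply: (@le_trans _ _ (2 * (e / 4)%:C)); first by rewrite ler_wpM2l.
    rewrite -(rmorph_nat (real_complex R) 2) -rmorphM lecR.
    by rewrite le_eqVlt; apply/orP; left; apply/eqP; field.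
  have [E KM] := main h he.
  rewrite /q [h *: _](mulr1 h) [h + x]addrC E.
  rewrite (_ : - D - _ = - (h * cintegral mu H (K h))); last first.
    by rewrite /GRing.scale /=; field.
  rewrite normrN normrM.
  apply: (@le_trans _ _ (eps / (M + 1)%:C * (M + 1)%:C)); last first.
    by rewrite divfK// gt_eqF.
  apply: ler_pM => //; apply: (le_trans (norm_le_norm1 _)).
  by rewrite lecR (le_trans KM)// lerDl.
split; first by apply/cvg_ex; exists (- D).
exact: cvg_lim lim.
Unshelve. all: by end_near. Qed.

End cauchy_transform.

(** * Cauchy transforms of the deformed weight *)

Section weight_transform.
Context {R : realType}.
Local Notation mu := (@lebesgue_measure R).
Local Notation H := (@halfline R).
Variables (a xi : R[i]) (s : R).
Local Notation w := (weight a xi s).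
Local Notation jump := (xi * cpow s (a + 1) * (expR (- s))%:C).
Hypotheses (a1 : -1 < complex.Re a) (s0 : 0 < s) (mw : has_moments w).

(** Integration by parts eliminates the kernel 1/(x-u)^2; it produces 1 + a, of which the 1 is
    cancelled by rewriting x as (x-u) + u. *)
Lemma derive_assoc_weight (p : {poly R[i]}) (x : R[i]^o) : cut_plane x ->
  x * 'D_1 (assoc w p : R[i]^o -> R[i]^o) x =
  assoc w (a *: p - 'X * p + 'X * p^`()) x - jump * (p.[s%:C] / (x - s%:C)).
Proof.
move=> cx; have dx := is_derive_assoc mw p cx; rewrite derive_val.
rewrite -(cintegral_by_parts p cx a1 s0 mw).
have i2 := cintegrable_cauchy2 p mw cx.
pose q := (1 + a) *: p - 'X * p + 'X * p^`().
have i3 := cintegrable_cauchy2 ('X * p) mw cx.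
have mH := @measurable_halfline R.
have i4 := cintegrable_cauchy1 q mw cx.
rewrite (_ : cintegral mu H (fun u => w u * _) = assoc w q x +
    cintegral mu H (fun u => w u * ('X * p).[u%:C] / (x - u%:C) ^+ 2)); last first.
  rewrite -cintegralD//; apply: eq_cintegral => u _.
  by rewrite /q !(hornerD, hornerN, hornerM, hornerX, hornerZ); ring.
have -> : a *: p - 'X * p + 'X * p^`() = q - p by rewrite /q scalerDl scale1r; ring.
rewrite assocD// assocN//.
(* From -x/(x-u)^2 = -1/(x-u) - u/(x-u)^2. *)
suff -> : x * - cintegral mu H (fun u => w u * p.[u%:C] / (x - u%:C) ^+ 2) =
  - assoc w p x - cintegral mu H (fun u => w u * ('X * p).[u%:C] / (x - u%:C) ^+ 2).
  by ring.
have i1 := cintegrable_cauchy1 p mw cx.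
rewrite mulrN -opprD; congr (- _); rewrite -cintegralZ// -cintegralD//.
apply: eq_cintegral => u /set_mem; rewrite halflineE => /ltW u0.
have xu := cut_plane_neq cx u0.
by rewrite hornerM hornerX; field.
Qed.

(** Below [s] the factor 1 - xi is absent, so the case xi = 1 is covered; the phase is nonzero
    because cos^2 + sin^2 = 1. *)
Lemma weight_neq0 (u : R) : 0 < u < s -> w u != 0.
Proof.
move=> /andP[u0 us]; rewrite /weight ltNge (ltW us) /= subr0 mul1r.
rewrite mulf_neq0 ?realC_neq0 ?expR_gt0// mulf_neq0 ?realC_neq0 ?powR_gt0//.
apply/eqP => -[c0 s00]; have := cos2Dsin2 (complex.Im a * ln u).
by rewrite c0 s00 expr0n addr0 => /esym/eqP; rewrite oner_eq0.
Qed.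

End weight_transform.

(** * From double moments to the moments of each weight *)

Section moments.
Context {R : realType}.
Local Notation mu := (@lebesgue_measure R).
Local Notation H := (@halfline R).
Local Notation QD := (@quadrant R).
Local Notation mH := (@measurable_halfline R).
Local Notation mQ := (@measurable_quadrant R).
Implicit Types (w : R -> R[i]) (f g p q : {poly R[i]}).

Lemma cintegrable_pairing w1 w2 f g : (forall j k, moment_finite w1 w2 j k) ->
  cintegrable (mu \x mu)%E QD (pairing_integrand w1 w2 f g).
Proof.
move=> m12; rewrite (_ : pairing_integrand _ _ _ _ = (fun u =>
  \sum_(j < size f) \sum_(k < size g) f`_j * g`_k *
    pairing_integrand w1 w2 'X^j 'X^k u)).
  apply: cintegrable_sum => [|j]; first exact: mQ.
  apply: cintegrable_sum => [|k]; first exact: mQ.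
  by apply: cintegrableZ; [exact: mQ|exact: m12].
apply/funext => u; rewrite /pairing_integrand (horner_coef f) (horner_coef g).
rewrite -mulrA big_distrlr /= mulr_sumr; apply: eq_bigr => j _.
rewrite mulr_sumr; apply: eq_bigr => k _.
by rewrite !hornerXn; ring.
Qed.

Lemma pairing_integrand_swap w1 w2 f g : pairing_integrand w2 w1 g f =
  (fun u => pairing_integrand w1 w2 f g (u.2, u.1)).
Proof.
apply/funext => -[x y]; rewrite /pairing_integrand /= [x + y]addrC.
by ring.
Qed.

Lemma moment_finite_swap w1 w2 j k : moment_finite w1 w2 j k ->
  moment_finite w2 w1 k j.
Proof.
move=> m12; rewrite /moment_finite pairing_integrand_swap.
exact: cintegrable_quadrant_swap.
Qed.

(* Fubini gives the integrability of [w2 y * y ^+ j / (x + y)] for almost every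
   [x]; one [x] with [w1 x != 0] is enough to remove the denominator. *)
Lemma has_moments_right w1 w2 (s : R) : 0 < s ->
  (forall x, 0 < x < s -> w1 x != 0) ->
  cmeasurable setT w2 -> (forall j k, moment_finite w1 w2 j k) -> has_moments w2.
Proof.
move=> s0 w10 mw2 m12; split=> // j.
have := ae_cintegrable_row2 (m1 := mu) (m2 := mu) mH mH (m12 0%N j) (m12 0%N j.+1).
move=> /(ae_pos_exists s0)[x /andP[x0 xs]]; rewrite halflineE => /(_ x0)[P1 P2].
have w1x : w1 x != 0 by rewrite w10// x0.
have iG := cintegrableZ (w1 x)^-1 mH (cintegrableD mH P2 (cintegrableZ x%:C mH P1)).
apply: (eq_cintegrable mH _ iG) => y /set_mem; rewrite halflineE => y0.
rewrite /pairing_integrand /= !hornerXn expr0 exprS rmorphD.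
have xy : x%:C + y%:C != 0 :> R[i].
  by rewrite -rmorphD realC_neq0 ?addr_gt0.
by field; rewrite xy w1x.
Qed.

End moments.

(** * The pairing and its Euler identity *)

Section pairing.
Context {R : realType}.
Local Notation mu := (@lebesgue_measure R).
Local Notation H := (@halfline R).
Local Notation QD := (@quadrant R).
Local Notation mH := (@measurable_halfline R).
Local Notation mQ := (@measurable_quadrant R).
Implicit Types (w : R -> R[i]) (f g p q : {poly R[i]}).

Lemma pairing_swap w1 w2 f g : (forall j k, moment_finite w1 w2 j k) ->
  pairing w2 w1 g f = pairing w1 w2 f g.
Proof.
move=> m12; rewrite /pairing pairing_integrand_swap.
exact/cintegral_quadrant_swap/cintegrable_pairing.
Qed.

Lemma pairingDl w1 w2 f1 f2 g : (forall j k, moment_finite w1 w2 j k) ->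
  pairing w1 w2 (f1 + f2) g = pairing w1 w2 f1 g + pairing w1 w2 f2 g.
Proof.
move=> m12; rewrite /pairing.
rewrite -(cintegralD mQ (cintegrable_pairing _ _ m12) (cintegrable_pairing _ _ m12)).
apply: eq_cintegral_quadrant => u _ _; rewrite /pairing_integrand hornerD; ring.
Qed.

Lemma pairingZl w1 w2 c f g : (forall j k, moment_finite w1 w2 j k) ->
  pairing w1 w2 (c *: f) g = c * pairing w1 w2 f g.
Proof.
move=> m12; rewrite /pairing -(cintegralZ _ mQ (cintegrable_pairing _ _ m12)).
apply: eq_cintegral_quadrant => u _ _; rewrite /pairing_integrand hornerZ; ring.
Qed.

Lemma pairingDr w1 w2 f g1 g2 : (forall j k, moment_finite w1 w2 j k) ->
  pairing w1 w2 f (g1 + g2) = pairing w1 w2 f g1 + pairing w1 w2 f g2.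
Proof.
move=> m12; have m21 j k := moment_finite_swap (m12 k j).
by rewrite -!(pairing_swap _ _ m12) pairingDl.
Qed.

Lemma pairingZr w1 w2 c f g : (forall j k, moment_finite w1 w2 j k) ->
  pairing w1 w2 f (c *: g) = c * pairing w1 w2 f g.
Proof.
move=> m12; have m21 j k := moment_finite_swap (m12 k j).
by rewrite -!(pairing_swap _ _ m12) pairingZl.
Qed.

Lemma pairingBl w1 w2 f1 f2 g : (forall j k, moment_finite w1 w2 j k) ->
  pairing w1 w2 (f1 - f2) g = pairing w1 w2 f1 g - pairing w1 w2 f2 g.
Proof. by move=> m12; rewrite pairingDl// -scaleN1r pairingZl// mulN1r. Qed.

Lemma pairingBr w1 w2 f g1 g2 : (forall j k, moment_finite w1 w2 j k) ->
  pairing w1 w2 f (g1 - g2) = pairing w1 w2 f g1 - pairing w1 w2 f g2.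
Proof. by move=> m12; rewrite pairingDr// -scaleN1r pairingZr// mulN1r. Qed.

Lemma quadrant_neq0 (u : R * R) : 0 < u.1 -> 0 < u.2 -> (u.1 + u.2)%:C != 0 :> R[i].
Proof. by move=> ? ?; rewrite realC_neq0 ?addr_gt0. Qed.

(** The factor x + y cancels the kernel, and the double integral splits into a product. *)
Lemma pairingXM w1 w2 f g : has_moments w1 -> has_moments w2 ->
  (forall j k, moment_finite w1 w2 j k) ->
  pairing w1 w2 ('X * f) g + pairing w1 w2 f ('X * g) = wint w1 f * wint w2 g.
Proof.
move=> mw1 mw2 m12.
have E u : 0 < u.1 -> 0 < u.2 -> pairing_integrand w1 w2 ('X * f) g u +
  pairing_integrand w1 w2 f ('X * g) u =
  w1 u.1 * f.[u.1%:C] * (w2 u.2 * g.[u.2%:C]).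
  move=> u1 u2; have := quadrant_neq0 u1 u2.
  rewrite /pairing_integrand !(hornerM, hornerX) rmorphD => u0.
  by field.
have iF := cintegrableD mQ (cintegrable_pairing ('X * f) g m12)
  (cintegrable_pairing f ('X * g) m12).
rewrite /pairing.
rewrite -(cintegralD mQ (cintegrable_pairing _ _ m12) (cintegrable_pairing _ _ m12)).
etransitivity; first exact: (eq_cintegral_quadrant E).
rewrite cintegral_quadrant /=; first last.
- by move=> x x0; apply: cintegrableZ; [exact: mH|exact: cintegrable_poly].
- exact: (eq_cintegrable_quadrant E iF).
rewrite mulrC /wint -cintegralZ; [|exact: mH|exact: cintegrable_poly].
apply: eq_cintegral => x _.
by rewrite (cintegralZ _ mH (cintegrable_poly g mw2)) [LHS]mulrC.
Qed.

(* In general integrable only when [f] or [g] vanishes at the origin. *)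
Definition pairing2_integrand w1 w2 f g (p : R * R) : R[i] :=
  w1 p.1 * w2 p.2 / (p.1 + p.2)%:C ^+ 2 * f.[p.1%:C] * g.[p.2%:C].

Definition pairing2 w1 w2 f g : R[i] :=
  cintegral (mu \x mu)%E QD (pairing2_integrand w1 w2 f g).

Lemma pairing2_integrand_swap w1 w2 f g : pairing2_integrand w2 w1 g f =
  (fun u => pairing2_integrand w1 w2 f g (u.2, u.1)).
Proof.
apply/funext => -[x y]; rewrite /pairing2_integrand /= [x + y]addrC.
by ring.
Qed.

(** The integrand is that of the pairing times y/(x+y), which lies between 0 and 1. *)
Lemma cintegrable_pairing2 w1 w2 f g : (forall j k, moment_finite w1 w2 j k) ->
  cintegrable (mu \x mu)%E QD (pairing2_integrand w1 w2 f ('X * g)).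
Proof.
move=> m12; apply: (@eq_cintegrable_quadrant _ (fun u : R * R =>
  pairing_integrand w1 w2 f g u * (u.2 / (u.1 + u.2))%:C)).
- move=> u u1 u2; have := quadrant_neq0 u1 u2.
  rewrite /pairing_integrand /pairing2_integrand !(hornerM, hornerX).
  rewrite rmorphM fmorphV rmorphD => u0.
  by field.
- apply: (@cintegrable_mulbnd _ _ _ (mu \x mu)%E QD (pairing_integrand w1 w2 f g)
    (fun u : R * R => (u.2 / (u.1 + u.2))%:C) 1).
  + exact: mQ.
  + exact: cintegrable_pairing.
  + have mc : cmeasurable QD (fun u : R * R => u.2%:C / (u.1%:C + u.2%:C)).
      have c1 : cmeasurable QD (fun u : R * R => u.1%:C).
        by apply: cmeasurable_real; apply: measurable_funTS; exact: measurable_fst.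
      have c2 : cmeasurable QD (fun u : R * R => u.2%:C).
        by apply: cmeasurable_real; apply: measurable_funTS; exact: measurable_snd.
      by apply: cmeasurableM => //; apply: cmeasurableV; exact: cmeasurableD.
    move: mc; under eq_fun do rewrite -rmorphD -fmorphV -rmorphM; exact.
  + move=> u; rewrite quadrantE => -[u1 u2].
    have u12 : 0 < u.1 + u.2 by rewrite addr_gt0.
    rewrite norm1_real ger0_norm ?(divr_ge0 (ltW u2) (ltW u12))//.
    by rewrite ler_pdivrMr// mul1r lerDr (ltW u1).
Qed.

Lemma pairing2_swap w1 w2 f g : (forall j k, moment_finite w1 w2 j k) ->
  pairing2 w2 w1 ('X * g) f = pairing2 w1 w2 f ('X * g).
Proof.
move=> m12; rewrite /pairing2 pairing2_integrand_swap.
exact/cintegral_quadrant_swap/cintegrable_pairing2.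
Qed.

(** From x/(x+y)^2 + y/(x+y)^2 = 1/(x+y); this is where the homogeneity of the kernel enters. *)
Lemma pairing2XM w1 w2 f g : (forall j k, moment_finite w1 w2 j k) ->
  pairing2 w1 w2 ('X * f) g + pairing2 w1 w2 f ('X * g) = pairing w1 w2 f g.
Proof.
move=> m12; have m21 j k := moment_finite_swap (m12 k j).
have i1 := cintegrable_quadrant_swap (cintegrable_pairing2 g f m21).
rewrite -pairing2_integrand_swap in i1.
rewrite /pairing2 -cintegralD; [|exact: mQ|exact: i1|exact: cintegrable_pairing2].
apply: eq_cintegral_quadrant => u u1 u2; have := quadrant_neq0 u1 u2.
rewrite /pairing_integrand /pairing2_integrand !(hornerM, hornerX) rmorphD => u0.
by field.
Qed.

(** For fixed [x] the inner integral is [cintegral_by_parts] at the point -x, whose boundary term is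
    a multiple of q(t)/(-x-t). Integrated against the first weight, this becomes the Cauchy
    transform of [p] at -t. *)
Lemma pairing_by_parts w1 (b psi : R[i]) (t : R) (w2 := weight b psi t) p q :
  -1 < complex.Re b -> 0 < t -> has_moments w1 -> has_moments w2 ->
  (forall j k, moment_finite w1 w2 j k) ->
  pairing w1 w2 p ((1 + b) *: q - 'X * q + 'X * q^`()) - pairing2 w1 w2 p ('X * q) =
  - (psi * cpow t (b + 1) * (expR (- t))%:C * q.[t%:C] * assoc w1 p (- t%:C)).
Proof.
move=> b1 t0 mw1 mw2 m12; set r := (_ + 'X * q^`()).
set ct := psi * _ * _.
have ip := cintegrable_pairing p r m12; have i2 := cintegrable_pairing2 p q m12.
pose G x y := w2 y *
    (((1 + b - y%:C) * q.[y%:C] + y%:C * q^`().[y%:C]) / (- x%:C - y%:C) +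
     y%:C * q.[y%:C] / (- x%:C - y%:C) ^+ 2).
have E u : 0 < u.1 -> 0 < u.2 -> pairing_integrand w1 w2 p r u +
  -1 * pairing2_integrand w1 w2 p ('X * q) u =
  - (w1 u.1 * p.[u.1%:C]) * G u.1 u.2.
  move=> u1 u2; have := quadrant_neq0 u1 u2.
  rewrite /G /pairing_integrand /pairing2_integrand.
  rewrite /r !(hornerD, hornerN, hornerM, hornerX, hornerZ) rmorphD => u0.
  by field; rewrite u0 -opprD oppr_eq0 u0.
have iF := cintegrableD mQ ip (cintegrableZ (-1) mQ i2).
rewrite -mulN1r /pairing /pairing2 -(cintegralZ _ mQ i2).
rewrite -(cintegralD mQ ip (cintegrableZ (-1) mQ i2)).
have iG x : 0 < x -> cintegrable mu H (G x).
  move=> x0; have cx := cut_planeN x0.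
  have j1 := cintegrable_cauchy1 r mw2 cx.
  have j2 := cintegrable_cauchy2 ('X * q) mw2 cx.
  apply: (eq_cintegrable mH _ (cintegrableD mH j1 j2)) => y _.
  by rewrite /G /r !(hornerD, hornerN, hornerM, hornerX, hornerZ); ring.
etransitivity; first exact: (eq_cintegral_quadrant E).
rewrite cintegral_quadrant /=; first last.
- by move=> x x0; apply: cintegrableZ; [exact: mH|exact: iG].
- exact: (eq_cintegrable_quadrant E iF).
have ct0 := cut_planeN t0.
rewrite /assoc -mulNr -cintegralZ; [|exact: mH|exact: cintegrable_cauchy1].
apply: eq_cintegral => x /set_mem; rewrite halflineE => x0.
rewrite (cintegralZ _ mH (iG x x0)).
rewrite (cintegral_by_parts q (cut_planeN x0) b1 t0 mw2) -/ct.
have xt : x%:C + t%:C != 0 :> R[i].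
  by rewrite -rmorphD realC_neq0 ?addr_gt0.
have xt1 : - x%:C - t%:C != 0 by rewrite -opprD oppr_eq0.
have xt2 : - t%:C - x%:C != 0 by rewrite addrC.
by field; rewrite ?xt1 ?xt2.
Qed.

(** Sum of [pairing_by_parts] in both variables: the two [pairing2] terms combine by [pairing2XM],
    the two terms with an extra X by [pairingXM]. *)
Lemma pairing_euler (a b xi psi : R[i]) (s t : R)
    (w1 := weight a xi s) (w2 := weight b psi t) p q :
  -1 < complex.Re a -> -1 < complex.Re b -> 0 < s -> 0 < t ->
  has_moments w1 -> has_moments w2 -> (forall j k, moment_finite w1 w2 j k) ->
  pairing w1 w2 ('X * p^`()) q + pairing w1 w2 p ('X * q^`()) =
  - (a + b + 1) * pairing w1 w2 p q + wint w1 p * wint w2 q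
  - xi * cpow s (a + 1) * (expR (- s))%:C * p.[s%:C] * assoc w2 q (- s%:C)
  - psi * cpow t (b + 1) * (expR (- t))%:C * q.[t%:C] * assoc w1 p (- t%:C).
Proof.
move=> a1 b1 s0 t0 mw1 mw2 m12; have m21 j k := moment_finite_swap (m12 k j).
have := pairing_by_parts p q b1 t0 mw1 mw2 m12.
have := pairing_by_parts q p a1 s0 mw2 mw1 m21.
rewrite (pairing_swap _ _ m12) -(pairing2_swap _ _ m21) -/w1 -/w2.
set c1 := xi * _ * _; set c2 := psi * _ * _.
rewrite (pairingDl _ _ _ m12) (pairingBl _ _ _ m12) (pairingZl _ _ _ m12).
rewrite (pairingDr _ _ _ m12) (pairingBr _ _ _ m12) (pairingZr _ _ _ m12).
have := pairing2XM p q m12; have := pairingXM p q mw1 mw2 m12.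
set A := pairing _ _ ('X * p) q; set B := pairing _ _ p ('X * q).
set C := pairing2 _ _ ('X * p) q; set D := pairing2 _ _ p ('X * q).
set E := pairing _ _ p q; set F := pairing _ _ _ q; set G := pairing _ _ p _.
move=> <- CD eq1 eq2.
have eq1' : F = - (c1 * p.[s%:C] * assoc w2 q (- s%:C)) + C + A - (1 + a) * E.
  by rewrite -eq1; ring.
have eq2' : G = - (c2 * q.[t%:C] * assoc w1 p (- t%:C)) + D + B - (1 + b) * E.
  by rewrite -eq2; ring.
by rewrite eq1' eq2' -CD; ring.
Qed.

End pairing.

(** * Expansions in a biorthogonal system *)

Section biorthogonal.
Context {R : realType}.
Implicit Types (f g p q : {poly R[i]}) (phi : {poly R[i]} -> R[i]).

Lemma linear_sum phi n (c : 'I_n -> R[i]) (F : 'I_n -> {poly R[i]}) :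
  scalar phi -> phi (\sum_(i < n) c i *: F i) = \sum_(i < n) c i * phi (F i).
Proof.
move=> lphi; have phi0 : phi 0 = 0.
  by have := lphi (-1) 0 0; rewrite scaler0 addr0 mulN1r addNr.
elim: n c F => [|n IH] c F; first by rewrite !big_ord0.
by rewrite !big_ord_recl lphi IH.
Qed.

Lemma poly_span (P : nat -> {poly R[i]}) n p : (forall n, size (P n) = n.+1) ->
  (size p <= n)%N -> exists c : nat -> R[i], p = \sum_(l < n) c l *: P l.
Proof.
move=> sP; elim: n p => [|n IH] p sp.
  by exists (fun=> 0); rewrite big_ord0; apply/eqP; rewrite -size_poly_leq0.
have lP : (P n)`_n != 0.
  have : lead_coef (P n) != 0 by rewrite lead_coef_eq0 -size_poly_eq0 sP.
  by rewrite lead_coefE sP.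
have [|c pc] := IH (p - (p`_n / (P n)`_n) *: P n).
  apply/leq_sizeP => j nj; rewrite coefB coefZ.
  move: nj; rewrite leq_eqVlt => /predU1P[<-|nj]; first by rewrite divfK// subrr.
  have /leq_sizeP /(_ j nj) -> := sp.
  have /leq_sizeP /(_ j nj) -> : (size (P n) <= n.+1)%N by rewrite sP.
  by rewrite mulr0 subr0.
exists (fun l => if (l < n)%N then c l else p`_n / (P n)`_n).
rewrite big_ord_recr /= ltnn -[LHS](subrK ((p`_n / (P n)`_n) *: P n)) pc.
by congr (_ + _); apply: eq_bigr => i _; rewrite ltn_ord.
Qed.

(** Leading coefficients appear as coefficients of index [n], ready for [coefXM] and [coef_deriv];
    the conditions are symmetric, so the system can be exchanged as a whole. *)
Definition biorthogonal (w1 w2 : R -> R[i]) (P Q : nat -> {poly R[i]})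
    (S_ : nat -> R[i]) :=
  [/\ forall n, size (P n) = n.+1, forall n, size (Q n) = n.+1,
      forall n, (P n)`_n = S_ n, forall n, (Q n)`_n = S_ n &
      forall m n, pairing w1 w2 (P m) (Q n) = (m == n)%:R].

Variables (w1 w2 : R -> R[i]) (P Q : nat -> {poly R[i]}) (S_ : nat -> R[i]).
Hypothesis m12 : forall j k, moment_finite w1 w2 j k.

Lemma biorthogonal_swap : biorthogonal w1 w2 P Q S_ -> biorthogonal w2 w1 Q P S_.
Proof.
move=> [sP sQ lP lQ PQ]; split=> // m n.
by rewrite (pairing_swap _ _ m12) PQ eq_sym.
Qed.

Hypothesis PQ : biorthogonal w1 w2 P Q S_.

Let pairing_linl g : scalar (fun f => pairing w1 w2 f g).
Proof. by move=> c f1 f2; rewrite (pairingDl _ _ _ m12) (pairingZl _ _ _ m12). Qed.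

Lemma biorthogonal_lead_neq0 n : S_ n != 0.
Proof.
have [sP _ lP _ _] := PQ; rewrite -lP.
have : lead_coef (P n) != 0 by rewrite lead_coef_eq0 -size_poly_eq0 sP.
by rewrite lead_coefE sP.
Qed.

Lemma biorthogonal_expand n p : (size p <= n)%N ->
  p = \sum_(l < n) pairing w1 w2 p (Q l) *: P l.
Proof.
have [sP sQ lP lQ oPQ] := PQ => /(poly_span sP)[c pc].
rewrite {1}pc; apply: eq_bigr => l _; congr (_ *: _).
rewrite pc (linear_sum _ _ (pairing_linl (Q l))) (bigD1 l)//= oPQ eqxx mulr1.
rewrite big1 ?addr0// => k kl; rewrite oPQ.
by rewrite (_ : (k == l :> nat) = false) ?mulr0//; exact/negbTE.
Qed.

(** In the expansion of [p] only the last basis polynomial has a term of degree [n]. *)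
Lemma pairing_lead n p : (size p <= n.+1)%N ->
  pairing w1 w2 p (Q n) = p`_n / S_ n.
Proof.
have [sP sQ lP lQ oPQ] := PQ => sp; have S0 := biorthogonal_lead_neq0 n.
have {2}-> := biorthogonal_expand sp.
rewrite coef_sum big_ord_recr /= coefZ lP.
rewrite big1 ?add0r ?mulfK// => l _; rewrite coefZ.
have /leq_sizeP -> : (size (P l) <= n)%N by rewrite sP.
  by rewrite mulr0.
by [].
Qed.

End biorthogonal.

(** * Multiplication by X in the biorthogonal basis *)

Section multiplication_by_X.
Context {R : realType}.
Implicit Types (phi psi : {poly R[i]} -> R[i]).
Variables (w1 w2 : R -> R[i]) (P Q : nat -> {poly R[i]}) (S_ : nat -> R[i]).
Hypothesis m12 : forall j k, moment_finite w1 w2 j k.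
Hypothesis PQ : biorthogonal w1 w2 P Q S_.

Lemma phat_linear phi n : scalar phi ->
  phi (Phat w2 P Q n) = - \sum_(k < n.+1) wint w2 (Q k) * phi (P k).
Proof.
move=> lphi; rewrite -(linear_sum _ _ lphi) /Phat.
have phi0 : phi 0 = 0.
  by have := lphi (-1) 0 0; rewrite scaler0 addr0 mulN1r addNr.
have := lphi (-1) (\sum_(k < n.+1) wint w2 (Q k) *: P k) 0.
by rewrite addr0 scaleN1r phi0 addr0 mulN1r.
Qed.

(** Only the last index leaves the span of the first n + 1 basis polynomials, with coefficient the
    ratio of leading coefficients. An arbitrary linear [phi] covers evaluations and Cauchy
    transforms alike. *)
Lemma mulX_sum phi n : scalar phi -> forall l : 'I_n.+1,
  phi ('X * P l) = \sum_(k < n.+1) pairing w1 w2 ('X * P l) (Q k) * phi (P k) +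
    (l == ord_max)%:R * (S_ n / S_ n.+1) * phi (P n.+1).
Proof.
have [sP sQ lP lQ oPQ] := PQ => lphi l.
have sX : (size ('X * P l)%R <= n.+2)%N.
  by rewrite mulrC (leq_trans (size_polyMleq _ _))// sP size_polyX addn2 ltnS ltn_ord.
rewrite {1}(biorthogonal_expand m12 PQ sX) (linear_sum _ _ lphi) big_ord_recr /=.
congr (_ + _ * _); rewrite (pairing_lead m12 PQ sX) coefXM /=.
have [->|ln] := eqVneq l ord_max; first by rewrite mul1r lP.
have /leq_sizeP -> // : (size (P l) <= n)%N.
  by rewrite sP ltn_neqAle -ltnS ltn_ord andbT; exact: ln.
by rewrite !mul0r.
Qed.

End multiplication_by_X.

(** * The Christoffel-Darboux formula for linear functionals *)

Section christoffel_darboux.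
Context {R : realType}.
Implicit Types (phi psi : {poly R[i]} -> R[i]).
Variables (w1 w2 : R -> R[i]) (P Q : nat -> {poly R[i]}) (S_ : nat -> R[i]).
Hypotheses (mw1 : has_moments w1) (mw2 : has_moments w2).
Hypothesis m12 : forall j k, moment_finite w1 w2 j k.
Hypothesis PQ : biorthogonal w1 w2 P Q S_.

Let m21 j k := moment_finite_swap (m12 k j).
Let QP := biorthogonal_swap m12 PQ.

(* Evaluation at [x] is the case [al = 0], the Cauchy transform at [x] the case
   [al = 1]. *)
Lemma christoffel_darboux phi psi (x y al be : R[i]) n :
  scalar phi -> scalar psi ->
  (forall f, phi ('X * f) = x * phi f - al * wint w1 f) ->
  (forall g, psi ('X * g) = y * psi g - be * wint w2 g) ->
  (x + y) * \sum_(l < n.+1) phi (P l) * psi (Q l) =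
  phi (Phat w2 P Q n) * psi (Qcheck w1 P Q n)
  - al * psi (Qcheck w1 P Q n) - be * phi (Phat w2 P Q n)
  + S_ n / S_ n.+1 * psi (Q n.+1) * phi (P n)
  + S_ n / S_ n.+1 * psi (Q n) * phi (P n.+1).
Proof.
move=> lphi lpsi phiX psiX; set r := S_ n / S_ n.+1.
(* [Qcheck] is, by conversion, [Phat] of the exchanged system, so [phat_linear] rewrites both. *)
rewrite -[Qcheck w1 P Q n]/(Phat w1 Q P n) !phat_linear//.
set SP := \sum_(k < n.+1) wint w2 (Q k) * phi (P k).
set SQ := \sum_(k < n.+1) wint w1 (P k) * psi (Q k).
have E l : (x + y) * (phi (P l) * psi (Q l)) =
    phi ('X * P l) * psi (Q l) + psi ('X * Q l) * phi (P l) +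
    al * (wint w1 (P l) * psi (Q l)) + be * (wint w2 (Q l) * phi (P l)).
  by rewrite phiX psiX; ring.
rewrite mulr_sumr (eq_bigr _ (fun (l : 'I_n.+1) _ => E l)) !big_split /= -!mulr_sumr.
rewrite -/SP -/SQ.
pose A (l k : 'I_n.+1) := pairing w1 w2 ('X * P l) (Q k).
pose B (l k : 'I_n.+1) := pairing w1 w2 (P k) ('X * Q l).
have -> : \sum_(l < n.+1) phi ('X * P l) * psi (Q l) =
    \sum_(l < n.+1) \sum_(k < n.+1) A l k * phi (P k) * psi (Q l) +
    r * psi (Q n) * phi (P n.+1).
  rewrite (eq_bigr (fun l : 'I_n.+1 => \sum_(k < n.+1) A l k * phi (P k) * psi (Q l) +
    (l == ord_max)%:R * (r * psi (Q l) * phi (P n.+1)))); last first.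
    move=> l _; rewrite (mulX_sum m12 PQ lphi l) mulrDl mulr_suml; congr (_ + _).
    by rewrite /r; ring.
  rewrite big_split /=; congr (_ + _); rewrite (bigD1 ord_max)//= eqxx mul1r.
  by rewrite big1 ?addr0// => l /negbTE ->; rewrite mul0r.
have -> : \sum_(l < n.+1) psi ('X * Q l) * phi (P l) =
    \sum_(l < n.+1) \sum_(k < n.+1) B k l * phi (P k) * psi (Q l) +
    r * psi (Q n.+1) * phi (P n).
  rewrite (eq_bigr (fun k : 'I_n.+1 => \sum_(l < n.+1) B k l * phi (P k) * psi (Q l) +
    (k == ord_max)%:R * (r * psi (Q n.+1) * phi (P k)))); last first.
    move=> k _; rewrite (mulX_sum m21 QP lpsi k) mulrDl mulr_suml; congr (_ + _).
      apply: eq_bigr => l _; rewrite (pairing_swap _ _ m12) /B; ring.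
    by rewrite /r; ring.
  rewrite big_split /= exchange_big /=; congr (_ + _).
  rewrite (bigD1 ord_max)//= eqxx mul1r.
  by rewrite big1 ?addr0// => l /negbTE ->; rewrite mul0r.
(* By [pairingXM] the two multiplication matrices add up to the rank-one matrix of products of
   single integrals; only the terms of index n + 1 survive outside it. *)
have AB : \sum_(l < n.+1) \sum_(k < n.+1) A l k * phi (P k) * psi (Q l) +
    \sum_(l < n.+1) \sum_(k < n.+1) B k l * phi (P k) * psi (Q l) = SP * SQ.
  rewrite -big_split /= /SP /SQ mulrC big_distrlr /=; apply: eq_bigr => l _.
  rewrite -big_split /=; apply: eq_bigr => k _.
  rewrite -mulrDl -mulrDl /A /B pairingXM//; ring.
rewrite mulrNN -AB; ring.
Qed.

End christoffel_darboux.

(** * The differential equation and its two forms *)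

Section associated_function.
Context {R : realType}.
Variables (a b xi psi : R[i]) (s t : R).
Variables (P Q : nat -> {poly R[i]}) (S_ : nat -> R[i]).
Local Notation w1 := (weight a xi s).
Local Notation w2 := (weight b psi t).
Local Notation cs := (xi * cpow s (a + 1) * (expR (- s))%:C).
Local Notation ct := (psi * cpow t (b + 1) * (expR (- t))%:C).
Hypotheses (a1 : -1 < complex.Re a) (b1 : -1 < complex.Re b).
Hypotheses (s0 : 0 < s) (t0 : 0 < t).
Hypothesis m12 : forall j k, moment_finite w1 w2 j k.
Hypothesis PQ : biorthogonal w1 w2 P Q S_.

Let m21 j k := moment_finite_swap (m12 k j).
Let QP := biorthogonal_swap m12 PQ.

Let mw1 : has_moments w1.
Proof.
exact: (has_moments_right t0 (@weight_neq0 _ b psi t) (cmeasurable_weight _ _ _) m21).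
Qed.

Let mw2 : has_moments w2.
Proof.
exact: (has_moments_right s0 (@weight_neq0 _ a xi s) (cmeasurable_weight _ _ _) m12).
Qed.

Let assoc_linear w (x : R[i]) : has_moments w -> cut_plane x ->
  scalar (fun f => assoc w f x).
Proof. by move=> mw cx c f g; rewrite assocD// assocZ. Qed.

(** The coefficients come from [pairing_euler]; its diagonal terms, among them the degree [n], are
    collected on the left. *)
Lemma euler_expansion n :
  'X * (P n)^`() + (a + b + n%:R + 1) *: P n =
  \sum_(l < n.+1) (wint w1 (P n) * wint w2 (Q l)
    - cs * (P n).[s%:C] * assoc w2 (Q l) (- s%:C)
    - ct * assoc w1 (P n) (- t%:C) * (Q l).[t%:C]) *: P l.
Proof.
have [sP sQ lP lQ oPQ] := PQ.
set p := (_ + _ *: P n).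
have sp : (size p <= n.+1)%N.
  rewrite (leq_trans (size_polyD _ _))// geq_max; apply/andP; split; last first.
    by rewrite (leq_trans (size_scale_leq _ _))// sP.
  rewrite mulrC (leq_trans (size_polyMleq _ _))// size_polyX addn2 /=.
  by have := lt_size_deriv (p := P n); rewrite -size_poly_eq0 sP => /(_ isT).
rewrite (biorthogonal_expand m12 PQ sp); apply: eq_bigr => l _; congr (_ *: _).
have := pairing_euler (P n) (Q l) a1 b1 s0 t0 mw1 mw2 m12.
have sX : (size ('X * (Q l)^`())%R <= n.+1)%N.
  rewrite mulrC (leq_trans (size_polyMleq _ _))// size_polyX addn2 /=.
  have := lt_size_deriv (p := Q l); rewrite -size_poly_eq0 sQ => /(_ isT) h.
  exact: leq_trans h (ltn_ord l).
(* X times the derivative of [Q l] has degree at most l <= n, so pairing with [P n] reads off its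
   coefficient of degree n: n times the leading coefficient if l = n, and 0 otherwise. *)
have -> : pairing w1 w2 (P n) ('X * (Q l)^`()) = n%:R * (n == l :> nat)%:R.
  rewrite -(pairing_swap _ _ m12) (pairing_lead m21 QP sX).
  have S0 := biorthogonal_lead_neq0 PQ n.
  case: n S0 l {sp sX p} => [|m] S0 l.
    by rewrite coefXM eqxx !mul0r.
  rewrite coefXM /= coef_deriv; case: eqP => [ml|/eqP ml].
    by rewrite -ml lQ mulr1 -[S_ _ *+ _]mulr_natr mulrAC divff// mul1r.
  have /leq_sizeP -> // : (size (Q l) <= m.+1)%N.
    by rewrite sQ ltn_neqAle eq_sym ml -ltnS ltn_ord.
  by rewrite mul0rn mul0r mulr0.
rewrite /p (pairingDl _ _ _ m12) (pairingZl _ _ _ m12) oPQ => h.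
set A := pairing _ _ _ _ in h *.
have -> : A = A + n%:R * (n == l :> nat)%:R - n%:R * (n == l :> nat)%:R by ring.
by rewrite h; ring.
Qed.

(** Inserting [euler_expansion] in [derive_assoc_weight] leaves a - (a + b + n + 1) = -(n + b + 1).
    The boundary term in 1/(x-s) is the summand of [K11] that completes the kernel sum, and
    multiplication by X supplies the 1 in 1 - [Phat] transform. *)
Lemma assoc_equation n (x : R[i]^o) : cut_plane x ->
  x * 'D_1 (assoc w1 (P n) : R[i]^o -> R[i]^o) x =
    - (n%:R + b + 1 + x) * assoc w1 (P n) x
    + wint w1 (P n) * (1 - assoc w1 (Phat w2 P Q n) x)
    - cs * (P n).[s%:C] * K11 w1 w2 P Q n x (- s%:C)
    - ct * assoc w1 (P n) (- t%:C) * K10 w1 P Q n x t%:C.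
Proof.
move=> cx; rewrite derive_assoc_weight//.
rewrite assocD// assocD// assocZ// assocN// assocXM//.
have := congr1 (fun f => assoc w1 f x) (euler_expansion n).
rewrite (linear_sum _ _ (assoc_linear mw1 cx)) assocD// assocZ//.
move=> /(canRL (addrK _)) ->.
rewrite (phat_linear w2 P Q n (assoc_linear mw1 cx)) /K11 /K10.
have -> : \sum_(l < n.+1) (wint w1 (P n) * wint w2 (Q l)
      - cs * (P n).[s%:C] * assoc w2 (Q l) (- s%:C)
      - ct * assoc w1 (P n) (- t%:C) * (Q l).[t%:C]) * assoc w1 (P l) x =
    wint w1 (P n) * (\sum_(l < n.+1) wint w2 (Q l) * assoc w1 (P l) x)
    - cs * (P n).[s%:C] *
      (\sum_(l < n.+1) assoc w1 (P l) x * assoc w2 (Q l) (- s%:C))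
    - ct * assoc w1 (P n) (- t%:C) *
      (\sum_(l < n.+1) assoc w1 (P l) x * (Q l).[t%:C]).
  by rewrite !mulr_sumr -!sumrB; apply: eq_bigr => l _; ring.
by ring.
Qed.

(** Christoffel-Darboux with two Cauchy transforms; multiplied by x - s, the extra summand of [K11]
    gives the 1 that completes the product of the two differences. *)
Lemma K11_quotient n (x : R[i]) : cut_plane x ->
  K11 w1 w2 P Q n x (- s%:C) =
  ((assoc w2 (Qcheck w1 P Q n) (- s%:C) - 1) * (assoc w1 (Phat w2 P Q n) x - 1)
   + S_ n / S_ n.+1 * assoc w2 (Q n.+1) (- s%:C) * assoc w1 (P n) x
   + S_ n / S_ n.+1 * assoc w2 (Q n) (- s%:C) * assoc w1 (P n.+1) x) / (x - s%:C).
Proof.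
move=> cx; have cs0 := cut_planeN s0.
have xs := cut_plane_neq cx (ltW s0).
apply: (canRL (mulfK xs)); rewrite mulrC /K11 mulrDr divff//.
rewrite (christoffel_darboux mw1 mw2 m12 PQ (phi := fun f => assoc w1 f x)
  (psi := fun g => assoc w2 g (- s%:C)) (al := 1) (be := 1))//.
- by ring.
- exact: assoc_linear.
- exact: assoc_linear.
- by move=> f; rewrite mul1r assocXM.
- by move=> f; rewrite mul1r assocXM.
Qed.

Lemma K10_quotient n (x : R[i]) : cut_plane x -> x != - t%:C ->
  K10 w1 P Q n x t%:C =
  ((Qcheck w1 P Q n).[t%:C] * (assoc w1 (Phat w2 P Q n) x - 1)
   + S_ n / S_ n.+1 * (Q n.+1).[t%:C] * assoc w1 (P n) x
   + S_ n / S_ n.+1 * (Q n).[t%:C] * assoc w1 (P n.+1) x) / (x + t%:C).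
Proof.
move=> cx; rewrite -subr_eq0 opprK => xt.
apply: (canRL (mulfK xt)); rewrite mulrC /K10.
rewrite (christoffel_darboux mw1 mw2 m12 PQ (phi := fun f => assoc w1 f x)
  (psi := fun g => g.[t%:C]) (al := 1) (be := 0))//.
- by ring.
- exact: assoc_linear.
- by move=> c f g; rewrite hornerD hornerZ.
- by move=> f; rewrite mul1r assocXM.
- by move=> f; rewrite hornerM hornerX mul0r subr0.
Qed.

Lemma derivable_assoc_weight n (x : R[i]^o) : cut_plane x ->
  derivable (assoc w1 (P n) : R[i]^o -> R[i]^o) x 1.
Proof.
by move=> cx; exact: (@ex_derive _ _ _ _ _ _ _ (is_derive_assoc mw1 (P n) cx)).
Qed.

End associated_function.

(** * The equations for both families *)

Theorem proposition4p3 (R : realType) (a b xi psi : R[i]) (s t : R)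
    (P Q : nat -> {poly R[i]}) (S_ : nat -> R[i]) :
  let w1 := weight a xi s in
  let w2 := weight b psi t in
  let Z := Zdet w1 w2 in
  let pi_ n := wint w1 (P n) in
  let eta n := wint w2 (Q n) in
  let P1 n := assoc w1 (P n) in
  let Q1 n := assoc w2 (Q n) in
  let Ph n := Phat w2 P Q n in
  let Qc n := Qcheck w1 P Q n in
  let Ph1 n := assoc w1 (Ph n) in
  let Qc1 n := assoc w2 (Qc n) in
  let sC := s%:C in
  let tC := t%:C in
  let cs := xi * cpow s (a + 1) * (expR (- s))%:C in
  let ct := psi * cpow t (b + 1) * (expR (- t))%:C in
  -1 < complex.Re a -> -1 < complex.Re b -> 0 < s -> 0 < t ->
  (forall j k, moment_finite w1 w2 j k) ->
  (forall n, Z n != 0) ->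
  (forall n, size (P n) = n.+1) -> (forall n, size (Q n) = n.+1) ->
  (forall n, lead_coef (P n) = S_ n) -> (forall n, lead_coef (Q n) = S_ n) ->
  (forall n, S_ n ^+ 2 = Z n / Z n.+1) ->
  (forall m n, pairing w1 w2 (P m) (Q n) = (m == n)%:R) ->
  (forall n, pi_ n != 0) -> (forall n, eta n != 0) ->
  forall n : nat,
  (forall x : R[i]^o, cut_plane x ->
    [/\ derivable (P1 n : R[i]^o -> R[i]^o) x 1,
      x * 'D_1 (P1 n : R[i]^o -> R[i]^o) x =
        - (n%:R + b + 1 + x) * P1 n x + pi_ n * (1 - Ph1 n x)
        - cs * (P n).[sC] * K11 w1 w2 P Q n x (- sC)
        - ct * P1 n (- tC) * K10 w1 P Q n x tC
    & x != - tC ->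
      x * 'D_1 (P1 n : R[i]^o -> R[i]^o) x =
        - (n%:R + b + 1 + x) * P1 n x + pi_ n * (1 - Ph1 n x)
        - cs * ((P n).[sC] / (x - sC)) *
          ((Qc1 n (- sC) - 1) * (Ph1 n x - 1)
           + S_ n / S_ n.+1 * Q1 n.+1 (- sC) * P1 n x
           + S_ n / S_ n.+1 * Q1 n (- sC) * P1 n.+1 x)
        - ct * (P1 n (- tC) / (x + tC)) *
          ((Qc n).[tC] * (Ph1 n x - 1)
           + S_ n / S_ n.+1 * (Q n.+1).[tC] * P1 n x
           + S_ n / S_ n.+1 * (Q n).[tC] * P1 n.+1 x)]) /\
  (forall y : R[i]^o, cut_plane y ->
    [/\ derivable (Q1 n : R[i]^o -> R[i]^o) y 1,
      y * 'D_1 (Q1 n : R[i]^o -> R[i]^o) y =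
        - (n%:R + a + 1 + y) * Q1 n y + eta n * (1 - Qc1 n y)
        - cs * Q1 n (- sC) * K01 w2 P Q n sC y
        - ct * (Q n).[tC] * K11 w1 w2 P Q n (- tC) y
    & y != - sC ->
      y * 'D_1 (Q1 n : R[i]^o -> R[i]^o) y =
        - (n%:R + a + 1 + y) * Q1 n y + eta n * (1 - Qc1 n y)
        - cs * (Q1 n (- sC) / (sC + y)) *
          ((Ph n).[sC] * (Qc1 n y - 1)
           + S_ n / S_ n.+1 * (P n.+1).[sC] * Q1 n y
           + S_ n / S_ n.+1 * (P n).[sC] * Q1 n.+1 y)
        - ct * ((Q n).[tC] / (y - tC)) *
          ((Ph1 n (- tC) - 1) * (Qc1 n y - 1)
           + S_ n / S_ n.+1 * P1 n.+1 (- tC) * Q1 n y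
           + S_ n / S_ n.+1 * P1 n (- tC) * Q1 n.+1 y)]).
Proof.
move=> w1 w2 Z pi_ eta P1 Q1 Ph Qc Ph1 Qc1 sC tC cs ct.
move=> a1 b1 s0 t0 m12 _ sP sQ lP lQ _ oPQ _ _ n.
have PQ : biorthogonal w1 w2 P Q S_.
  split=> // k; first by rewrite -lP lead_coefE sP.
  by rewrite -lQ lead_coefE sQ.
have m21 j k := moment_finite_swap (m12 k j).
have QP := biorthogonal_swap m12 PQ.
split=> [x cx|y cy].
  have E := assoc_equation a1 b1 s0 t0 m12 PQ n cx.
  split; first exact: (derivable_assoc_weight t0 m12 cx).
    exact: E.
  move=> xt; rewrite E (K11_quotient s0 t0 m12 PQ n cx).
  rewrite (K10_quotient s0 t0 m12 PQ n cx xt).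
  rewrite /P1 /Q1 /Ph1 /Qc1 /Ph /Qc /pi_ /cs /ct /sC /tC /w1 /w2; ring.
(* The kernels are compatible with the exchange of the two variables, so the lemmas above, applied
   with (a, xi, s) and (b, psi, t) interchanged, give the second equation. *)
have K11C : K11 w2 w1 Q P n y (- tC) = K11 w1 w2 P Q n (- tC) y.
  by rewrite /K11 addrC [in RHS]addrC [y + _]addrC; congr (_ + _);
    apply: eq_bigr => l _; rewrite mulrC.
have K10C : K10 w2 Q P n y sC = K01 w2 P Q n sC y.
  by rewrite /K10 /K01; apply: eq_bigr => l _; rewrite mulrC.
have E := assoc_equation b1 a1 t0 s0 m21 QP n cy.
rewrite K11C K10C in E.
split; first exact: (derivable_assoc_weight s0 m21 cy).
  rewrite E /P1 /Q1 /Ph1 /Qc1 /Ph /Qc /eta /cs /ct /sC /tC /w1 /w2.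
  rewrite -[Qcheck (weight a xi s) P Q n]/(Phat (weight a xi s) Q P n).
  ring.
move=> ys; rewrite E -K11C -K10C (K11_quotient t0 s0 m21 QP n cy).
rewrite (K10_quotient t0 s0 m21 QP n cy ys).
rewrite /P1 /Q1 /Ph1 /Qc1 /Ph /Qc /eta /cs /ct /sC /tC /w1 /w2.
rewrite -[Qcheck (weight a xi s) P Q n]/(Phat (weight a xi s) Q P n).
rewrite -[Qcheck (weight b psi t) Q P n]/(Phat (weight b psi t) P Q n).
rewrite [s%:C + y]addrC; ring.
Qed.
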